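(* Let $(a_n)_{n=1}^\infty$ be an $L^2$-good universal sequence of natural numbers such that $(a_n\theta)_{n=1}^\infty$ is uniformly distributed modulo $1$ for every irrational number $\theta$. For any positive integer $l$, the following hold for $\mu$-almost every $\alpha\in B(0,1)$: (i) $\displaystyle\lim_{n\to\infty}\frac1n\cdot\#\left\{1\le j\le n:|c_{a_j}(\alpha)|=p^{\frac le}\right\}=\frac{p^f-1}{p^{fl}}$; (ii) $\displaystyle\lim_{n\to\infty}\frac1n\cdot\#\left\{1\le j\le n:|c_{a_j}(\alpha)|\ge p^{\frac le}\right\}=\frac{1}{p^{f(l-1)}}$. If $k$ is another positive integer with $k<l$, then for $\mu$-almost every $\alpha\in B(0,1)$: (iii) $\displaystyle\lim_{n\to\infty}\frac1n\cdot\#\left\{1\le j\le n:p^{\frac ke}\le|c_{a_j}(\alpha)|<p^{\frac le}\right\}=\frac{1}{p^{f(k-1)}}\left(1-\frac{1}{p^{f(l-k)}}\right)$.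
   Context: Let $p$ be a prime and let $K$ be a finite extension of $\mathbb{Q}_p$ of degree $m$, with ramification index $e$ and residue degree $f$ (so $m=ef$). Let $|\cdot|$ be the unique extension to $K$ of the $p$-adic absolute value with $|p|=p^{-1}$. Let $L\subseteq K$ be the unramified subextension of degree $f$ over $\mathbb{Q}_p$, write $L=\mathbb{Q}_p(\gamma)$ with $\gamma$ a primitive $(p^f-1)$-th root of unity, and fix $\beta\in K$ with $K=L(\beta)$ and $|\beta|=p^{1/e}$. For $b=\sum_{j\ge n_0}a_jp^j\in\mathbb{Q}_p$ with digits $a_j\in\{0,1,\dots,p-1\}$ put $\lfloor b\rfloor_p=\sum_{n_0\le j\le 0}a_jp^j$ (which is $0$ if $|b|<1$). Every $\alpha\in K$ is uniquely $\alpha=\sum_{i=0}^{e-1}\sum_{j=0}^{f-1}b_{i,j}\gamma^j\beta^i$ with $b_{i,j}\in\mathbb{Q}_p$, and $\lfloor\alpha\rfloor=\sum_{i=0}^{e-1}\sum_{j=0}^{f-1}\lfloor b_{i,j}\rfloor_p\gamma^j\beta^i$. Let $B(0,1)=\{x\in K:|x|<1\}$, and let $\mu$ be the restriction to $B(0,1)$ (with its Borel $\sigma$-algebra) of the Haar measure of the additive group $K$, normalized by $\mu(B(0,1))=1$. The continued fraction map $T:B(0,1)\to B(0,1)$ is $T(\alpha)=\frac1\alpha-\left\lfloor\frac1\alpha\right\rfloor$ for $\alpha\ne 0$ and $T(0)=0$. The $n$-th partial quotient of $\alpha\in B(0,1)$ is $c_n(\alpha)=\lfloor 1/T^{n-1}(\alpha)\rfloor$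 for $n\ge 1$, defined when $T^{n-1}(\alpha)\neq 0$ (so all $c_n(\alpha)$ are defined for $\mu$-almost every $\alpha$). A strictly increasing sequence of positive integers $(a_n)_{n\ge1}$ is $L^2$-good universal if for each measure-preserving dynamical system $(X,\mathcal{C},\nu,S)$ on a probability space and each $g\in L^2(X,\mathcal{C},\nu)$ the limit $\lim_{n\to\infty}\frac1n\sum_{j=1}^n g(S^{a_j-1}x)$ exists for $\nu$-almost every $x$. A real sequence $(x_n)_{n\ge1}$ is uniformly distributed modulo $1$ if for each interval $I\subseteq[0,1)$, $\lim_{n\to\infty}\frac1n\#\{1\le j\le n:\{x_j\}\in I\}$ equals the length of $I$, where $\{x_j\}$ is the fractional part. *)

(* Defs.v *)
From HB Require Import structures.
From mathcomp Require Import all_boot all_order all_algebra all_field.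
From mathcomp Require Import all_classical all_reals all_analysis.
Set Implicit Arguments.
Unset Strict Implicit.
Unset Printing Implicit Defensive.
Import Order.TTheory GRing.Theory Num.Theory.
Import numFieldNormedType.Exports.
Local Open Scope classical_set_scope.
Local Open Scope ring_scope.

Definition absolute_value (R : realType) (F : fieldType) (v : F -> R) : Prop :=
  [/\ forall x, 0 <= v x,
      forall x, v x = 0 <-> x = 0,
      forall x y, v (x * y) = v x * v y &
      forall x y, v (x + y) <= v x + v y].

Definition complete_abs (R : realType) (F : fieldType) (v : F -> R) : Prop :=
  forall u : nat -> F,
    (forall eps : R, 0 < eps -> exists N : nat, forall i j : nat,
       (N <= i)%N -> (N <= j)%N -> v (u i - u j) < eps) ->
    exists l : F, (fun n => v (u n - l)) @ \oo --> (0 : R).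

Definition padic_abs (R : realType) (p : nat) (r : rat) : R :=
  if r == 0 then 0
  else p%:R ^ ((logn p `|denq r|%N)%:Z - (logn p `|numq r|%N)%:Z).

(* (Qp, v) is the field of p-adic numbers: the completion of the rationals
   for the p-adic absolute value, which is unique up to a unique isometric
   isomorphism. *)
Definition is_padic_field (R : realType) (p : nat) (Qp : fieldType)
    (v : Qp -> R) : Prop :=
  [/\ absolute_value v,
      forall r : rat, v (ratr r) = padic_abs R p r,
      complete_abs v &
      forall (x : Qp) (eps : R), 0 < eps -> exists r : rat, v (x - ratr r) < eps].

Section Extension.
Context (R : realType) (Qp : fieldType) (vQ : Qp -> R).
Context (K : fieldExtType Qp) (v : K -> R).

Definition value_group (E : {vspace K}) : set R :=
  [set v x | x in [set x : K | x \in E /\ x != 0]].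

(* The index of the value group of Qp in that of E is e: there are exactly
   e cosets. *)
Definition ramification_index (E : {vspace K}) (e : nat) : Prop :=
  ([set [set r * s | s in value_group 1%VS] | r in value_group E] #= `I_e)%card.

(* The residue field of E has degree f over that of Qp: the reductions of
   u_0, ..., u_(f-1) form a basis. Conditions 2 and 3 say that they span and
   that they are linearly independent. *)
Definition residue_degree (E : {vspace K}) (f : nat) : Prop :=
  exists u : 'I_f -> K,
    [/\ forall i, u i \in E /\ v (u i) <= 1,
        forall x, x \in E -> v x <= 1 ->
          exists c : 'I_f -> Qp,
            (forall i, vQ (c i) <= 1) /\ v (x - \sum_i c i *: u i) < 1 &
        forall c : 'I_f -> Qp, (forall i, vQ (c i) <= 1) ->
          v (\sum_i c i *: u i) < 1 -> forall i, vQ (c i) < 1].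

End Extension.

Section Floor.
Context (R : realType) (p : nat) (Qp : fieldType) (vQ : Qp -> R).

(* b = sum_(j >= - M) a_j p^j with digits a_j; a k is the digit of p^(k - M).
   Leading zero digits are allowed, so every b has such an expansion. *)
Definition digit_expansion (b : Qp) (M : nat) (a : nat -> nat) : Prop :=
  (forall k, (a k < p)%N) /\
  (fun N : nat => vQ (b - \sum_(k < N) (a k)%:R * p%:R ^ (k%:Z - M%:Z)))
    @ \oo --> (0 : R).

(* The digit of p^(k - M) is kept exactly when k <= M. If (Qp, vQ) is the
   field of p-adic numbers, then this set is a singleton. *)
Definition padic_floor (b : Qp) : Qp :=
  xget 0 [set y | exists (M : nat) (a : nat -> nat), digit_expansion b M a /\
    y = \sum_(k < M.+1) (a k)%:R * p%:R ^ (k%:Z - M%:Z)].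

Context (K : fieldExtType Qp) (e f : nat) (gamma beta : K).

(* This set is a singleton when the gamma^j beta^i form a basis of K. *)
Definition ext_floor (alpha : K) : K :=
  xget 0 [set y | exists b : 'I_e -> 'I_f -> Qp,
    alpha = \sum_i \sum_j b i j *: (gamma ^+ j * beta ^+ i) /\
    y = \sum_i \sum_j padic_floor (b i j) *: (gamma ^+ j * beta ^+ i)].

Definition cf_map (alpha : K) : K :=
  if alpha == 0 then 0 else alpha^-1 - ext_floor alpha^-1.

(* The n-th partial quotient, for n >= 1. It is 0 when it is not defined, as
   0^-1 = 0; a defined partial quotient of an element of the open unit ball has
   absolute value > 1. *)
Definition partial_quotient (n : nat) (alpha : K) : K :=
  ext_floor (iter n.-1 cf_map alpha)^-1.

End Floor.

Definition abs_ball (R : realType) (V : zmodType) (v : V -> R) (x : V) (r : R) :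
  set V := [set y | v (y - x) < r].

(* V with the topology defined by v; the open sets below form a topology
   whatever the function v. *)
Definition abs_space (R : realType) (V : zmodType) (v : V -> R) : Type := V.

Section AbsTopology.
Context (R : realType) (V : zmodType) (v : V -> R).

Definition abs_open : set_system V :=
  [set A | forall x, A x -> exists2 r : R, 0 < r & abs_ball v x r `<=` A].

Lemma abs_openT : abs_open setT.
Proof. by move=> x _; exists 1. Qed.

Lemma abs_openI : setI_closed abs_open.
Proof.
move=> A B oA oB x [/oA[r r0 rA] /oB[s s0 sB]].
exists (Num.min r s); first by rewrite lt_min r0 s0.
by move=> y; rewrite /abs_ball /= lt_min => /andP[yr ys]; split;
  [exact: rA|exact: sB].
Qed.

Lemma abs_open_bigcup (I : Type) (g : I -> set V) :
  (forall i, abs_open (g i)) -> abs_open (\bigcup_i g i).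
Proof.
move=> og x [i _ /og[r r0 rg]]; exists r => // y /rg gy.
by exists i.
Qed.

HB.instance Definition _ := Choice.on (abs_space v).
HB.instance Definition _ := isPointed.Build (abs_space v) (0 : V).
HB.instance Definition _ := isOpenTopological.Build (abs_space v)
  abs_openT abs_openI abs_open_bigcup.

End AbsTopology.

(* V with its Borel sigma-algebra. *)
Notation borel_space v := (g_sigma_algebraType (@open (abs_space v))).

(* No regularity is required: on a finite extension of the p-adic numbers,
   which is locally compact and second countable, it follows from
   finiteness on compact sets. *)
Definition is_haar_measure (R : realType) (V : zmodType) (v : V -> R)
    (mu : {measure set (borel_space v) -> \bar R}) : Prop :=
  [/\ forall (a : V) (A : set (borel_space v)), measurable A ->
        mu [set a + x | x in (A : set V)] = mu A,
      forall C : set (abs_space v), compact C -> (mu C < +oo)%E &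
      mu setT != 0%E].

Definition measure_preserving (R : realType) (d : measure_display)
    (X : measurableType d) (nu : probability X R) (S : X -> X) : Prop :=
  measurable_fun setT S /\
  forall A : set X, measurable A -> nu (S @^-1` A) = nu A.

(* A sequence (a_n)_(n >= 1) is a function on nat whose value at 0 is unused. *)
Definition L2_good_universal (R : realType) (a : nat -> nat) : Prop :=
  [/\ forall n, (0 < n)%N -> (0 < a n)%N,
      forall i j, (0 < i)%N -> (i < j)%N -> (a i < a j)%N &
      forall (d : measure_display) (X : measurableType d)
             (nu : probability X R) (S : X -> X) (g : X -> R),
        measure_preserving nu S -> g \in Lfun nu 2%:E ->
        {ae nu, forall x,
           cvgn (fun n : nat =>
             n%:R^-1 * \sum_(1 <= j < n.+1) g (iter (a j).-1 S x))}].

(* n^-1 times the number of j with 1 <= j <= n and P j. *)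
Definition frequency (R : realType) (P : pred nat) (n : nat) : R :=
  (count P (iota 1 n))%:R / n%:R.

Definition frac_part (R : realType) (x : R) : R := x - (Num.floor x)%:~R.

Definition unif_distr_mod1 (R : realType) (x : nat -> R) : Prop :=
  forall I : interval R, [set` I] `<=` `[0, 1[ ->
    frequency R (fun j => frac_part (x j) \in I) @ \oo
      --> fine (lebesgue_measure [set` I]).

(* Main.v *)
Require Import Defs.
From HB Require Import structures.
From mathcomp Require Import all_boot all_order all_algebra all_field.
From mathcomp Require Import all_classical all_reals all_analysis.
From mathcomp Require Import measurable_realfun.
From mathcomp Require Import ring lra zify.
Set Implicit Arguments.
Unset Strict Implicit.
Unset Printing Implicit Defensive.
Import Order.TTheory GRing.Theory Num.Theory.
Import numFieldNormedType.Exports.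
Local Open Scope classical_set_scope.
Local Open Scope ring_scope.

(* The floor function selects one point in each coset of the open unit ball B,
   so on B minus 0 the map T x = 1/x - floor(1/x) has full branches: the
   inverse branches are y |-> 1/(c + y), for the floor values c with |c| > 1,
   and inversion scales the Haar measure of the subsets of a sphere |x| = r by
   a constant.  With b = |beta| it follows that
     mu({|x| = b^-l} `&` T^-1 A) = mu({|x| = b^-l}) * mu(A)   for A `<=` B,
   that is, T preserves mu and the absolute values of the partial quotients are
   independent and identically distributed.  The strong law of large numbers
   (second moments along the squares, then interpolation) gives the frequencies
   along any strictly increasing sequence.
   The floor has this property because the gamma^j beta^i form an orthogonal
   basis: |sum b_ij gamma^j beta^i| = max |b_ij| |beta|^i.  Orthogonality of the
   gamma^j is a count of residue classes, and spanning follows by successive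
   approximation and completeness. *)

(** * The strong law of large numbers for pairwise independent events *)

(** On the sphere |x| = r one has |1/x - 1/y| = |x - y| / r^2, so inversion carries small balls to
    balls; this is the source of the scaling factor. The measure identities are stated for open
    sets: spheres are open, and an open subset of B minus 0 has an open preimage in B, so all events
    met below are open and the measurability of T never comes up. The point 0, where T is set to 0,
    is a null set that lies on no sphere. With a union of spheres in place of one sphere, the
    identity makes the absolute value of the first partial quotient independent of the later ones;
    invariance reduces any two indices to this case, and pairwise independence is what the second
    moments use. *)

Lemma sqr_bracket (n : nat) : exists k : nat, (k ^ 2 <= n < k.+1 ^ 2)%N.
Proof.
elim: n => [|n [k /andP[kn nk]]]; first by exists 0%N.
have [ltk|gek] := ltnP n.+1 (k.+1 ^ 2); first by exists k; lia.
by exists k.+1; rewrite gek /=; lia.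
Qed.

(** Between k^2 and (k+1)^2 the sequence grows by at most 2k, which is negligible against k^2. *)
Lemma cvg_average_squares (R : realType) (s : nat -> R) (q : R) :
  (forall i, 0 <= s i.+1 - s i <= 1) ->
  (fun k => s (k.+1 ^ 2)%N / (k.+1 ^ 2)%:R) @ \oo --> q ->
  (fun n => s n / n%:R) @ \oo --> q.
Proof.
move=> s01 sq.
have incr m i : 0 <= s (m + i)%N - s m <= i%:R.
  elim: i => [|i /andP[IH1 IH2]]; first by rewrite addn0 subrr lexx.
  have /andP[h1 h2] := s01 (m + i)%N.
  by rewrite addnS -[i.+1]addn1 natrD; apply/andP; split; lra.
apply/cvgrPdist_lt => eps eps0.
have e3 : 0 < eps / 3 by lra.
have /cvgrPdist_lt/(_ _ e3)[N _ HN] := sq.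
(* For k > [C] the error 2k(1 + |q|) caused by the gap between squares is at most two thirds of eps
   k^2; [e3] accounts for the remaining third. *)
pose C := 3 * (3 + `|q|) / eps.
have C0 : 0 <= C by rewrite /C divr_ge0 ?mulr_ge0 ?addr_ge0// ltW.
pose M := (N + 2 + (Num.trunc C).+1)%N.
exists (M ^ 2)%N => // n /= Mn.
have [k /andP[kn nk]] := sqr_bracket n.
have Mk : (M <= k)%N by rewrite -ltnS -(ltn_exp2r _ _ (isT : 0 < 2)%N) (leq_ltn_trans Mn).
have kC : C < k%:R.
  by rewrite (lt_le_trans (truncnS_gt _))// ler_nat (leq_trans _ Mk)// leq_addl.
have k0 : (0 < k)%N by rewrite (leq_trans _ Mk)// /M addnAC addn_gt0 orbT.
have /HN : (N <= k.-1)%N.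
  rewrite -ltnS prednK// (leq_trans _ Mk)// /M -addnA addnC.
  by rewrite addnC -[ltnLHS]addn0 ltn_add2l.
rewrite /= prednK// => dk.
have /andP[r0 r1] := incr (k ^ 2)%N (n - k ^ 2)%N.
rewrite subnKC// in r0 r1.
have nk2 : (n - k ^ 2)%:R <= 2 * k%:R :> R.
  rewrite -natrM ler_nat leq_subLR -ltnS (leq_trans nk)// -addn1 sqrnD muln1.
  by rewrite exp1n; lia.
have K0 : 0 < (k%:R : R) by rewrite ltr0n.
have nE : (n%:R : R) = (k ^ 2)%:R + (n - k ^ 2)%:R by rewrite -natrD subnKC.
have K2 : (k ^ 2)%:R = k%:R ^+ 2 :> R by rewrite natrX.
have d0 : 0 <= (n - k ^ 2)%:R :> R by [].
have n0 : 0 < n%:R :> R by rewrite nE K2 ltr_wpDr// exprn_gt0.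
have scale (x m c : R) : 0 < m -> (`|q - x / m| < c) = (`|q * m - x| < c * m).
  move=> m0; rewrite -[in LHS](ltr_pM2r m0) -{2}(gtr0_norm m0) -normrM.
  by rewrite mulrBl divfK// gt_eqF.
move: dk; rewrite !scale ?K2 ?exprn_gt0// => dk.
have qd : `|q * (n - k ^ 2)%:R| <= `|q| * (2 * k%:R).
  by rewrite normrM (ger0_norm d0) ler_wpM2l.
have /(ler_wpM2l (ltW K0)) : 3 * (3 + `|q|) <= k%:R * eps.
  by rewrite -ler_pdivrMr// ltW.
have ed : 0 <= eps * (n - k ^ 2)%:R by rewrite mulr_ge0// ltW.
move: qd dk; rewrite nE K2 mulrDr !ler_norml !ltr_norml => /andP[? ?] /andP[? ?] ?.
have -> : k%:R ^+ 2 = k%:R * k%:R :> R by [].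
by apply/andP; split; lra.
Qed.

Section Slln.
Context (R : realType) (d : measure_display) (T : measurableType d).
Context (P : probability T R) (W : nat -> set T) (q : R).
Hypotheses (mW : forall i, measurable (W i)) (PW : forall i, P (W i) = q%:E).
Hypothesis PWI : forall i j, i <> j -> P (W i `&` W j) = (q ^+ 2)%:E.

Let S n x : R := \sum_(i < n) \1_(W i) x.

Let mS n : measurable_fun setT (S n).
Proof. by apply: measurable_sum => i; exact: measurable_indic. Qed.

Let mSE n (f : R -> R) : measurable_fun setT f ->
  measurable_fun setT (fun x => (f (S n x))%:E).
Proof. by move=> mf; apply/measurable_EFinP; exact: measurableT_comp. Qed.

Let integral_W i : (\int[P]_x (\1_(W i) x)%:E = q%:E)%E.
Proof. by rewrite integral_indic// setIT; exact: PW. Qed.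

Let integral_S n : (\int[P]_x (S n x)%:E = (n%:R * q)%:E)%E.
Proof.
under eq_integral do rewrite /S -sumEFin.
rewrite ge0_integral_sum//.
- under eq_bigr do rewrite integral_W.
  by rewrite sumEFin sumr_const card_ord mulr_natl.
- by move=> i; apply/measurable_EFinP; exact: measurable_indic.
Qed.

Let integral_sqrS n :
  (\int[P]_x (S n x ^+ 2)%:E = (n%:R * q + (n%:R ^+ 2 - n%:R) * q ^+ 2)%:E)%E.
Proof.
have -> : (\int[P]_x (S n x ^+ 2)%:E =
    \sum_(i < n) \sum_(j < n) \int[P]_x (\1_(W i `&` W j) x)%:E)%E.
  under eq_integral => x _.
    rewrite /S expr2 mulr_suml.
    under eq_bigr do rewrite mulr_sumr.
    rewrite -sumEFin.
    under eq_bigr do rewrite -sumEFin.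
    under eq_bigr => i _.
      under eq_bigr => j _ do rewrite -[_ * _]/((\1_(W i) \* \1_(W j)) x) -indicI.
      over.
    over.
  have mI (i j : nat) : measurable_fun setT (fun x => (\1_(W i `&` W j) x : R)%:E).
    by apply/measurable_EFinP; apply: measurable_indic; exact: measurableI.
  rewrite ge0_integral_sum//.
  - by apply: eq_bigr => i _; rewrite ge0_integral_sum.
  - by move=> i; apply: emeasurable_sum.
  - by move=> i x _; apply: sume_ge0 => j _; rewrite lee_fin.
under eq_bigr => i _.
  under eq_bigr => j _.
    have -> : (\int[P]_x (\1_(W i `&` W j) x)%:E =
        (q ^+ 2 + (j == i)%:R * (q - q ^+ 2))%:E)%E.
      case: eqP => [->|/eqP ji]; first by rewrite setIid integral_W mul1r addrC subrK.
      rewrite integral_indic//; last exact: measurableI.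
      by rewrite setIT mul0r addr0; apply: PWI; apply/eqP; rewrite eq_sym.
    over.
  have -> : (\sum_(j < n) (q ^+ 2 + (j == i :> nat)%:R * (q - q ^+ 2))%:E =
      (n%:R * q ^+ 2 + (q - q ^+ 2))%:E)%E.
    rewrite sumEFin big_split/= sumr_const card_ord; congr (_ + _)%:E.
      by rewrite mulr_natl.
    rewrite (bigD1 i)//= eqxx mul1r big1 ?addr0// => j.
    by rewrite -val_eqE => /= /negPf ->; rewrite mul0r.
  over.
rewrite sumEFin sumr_const card_ord; congr EFin.
rewrite -[LHS]mulr_natl; ring.
Qed.

(* The cross term of the square is moved to the other side, so that only integrals
   of nonnegative functions occur. *)
Let integral_dev n :
  (\int[P]_x ((S n x - n%:R * q) ^+ 2)%:E = (n%:R * (q - q ^+ 2))%:E)%E.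
Proof.
have q0 : 0 <= q by rewrite -lee_fin -(PW 0).
have S0 x : 0 <= S n x by apply: sumr_ge0 => i _; rewrite indicE.
have : (\int[P]_x ((S n x - n%:R * q) ^+ 2)%:E
        + \int[P]_x (2 * n%:R * q * S n x)%:E =
        \int[P]_x (S n x ^+ 2)%:E + \int[P]_x ((n%:R * q) ^+ 2)%:E)%E.
  rewrite -!ge0_integralD//.
  - by apply: eq_integral => x _; rewrite -!EFinD; congr EFin; ring.
  - by move=> x _; rewrite lee_fin sqr_ge0.
  - by apply: (@mSE _ (fun y => y ^+ 2)); exact: measurable_funX.
  - by move=> x _; rewrite lee_fin sqr_ge0.
  - by move=> x _; rewrite lee_fin sqr_ge0.
  - apply: (@mSE _ (fun y => (y - n%:R * q) ^+ 2)).
    by apply: measurable_funX; exact: measurable_funB.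
  - by move=> x _; rewrite lee_fin !mulr_ge0.
  - by apply: (@mSE _ (fun y => 2 * n%:R * q * y)); exact: mulrl_measurable.
have -> : (\int[P]_x (2 * n%:R * q * S n x)%:E =
           (2 * n%:R * q * (n%:R * q))%:E)%E.
  under eq_integral do rewrite EFinM.
  rewrite ge0_integralZl_EFin//; first by rewrite integral_S.
  - by move=> x _; rewrite lee_fin.
  - by apply: (@mSE _ (id)).
  - by rewrite !mulr_ge0.
rewrite integral_sqrS integral_cst//= probability_setT mule1 -EFinD.
move=> /(congr1 (fun z => z - (2 * n%:R * q * (n%:R * q))%:E)%E).
rewrite addeK// => ->; rewrite -EFinB; congr EFin; ring.
Qed.

(** Sampling at squares makes the variances (q - q^2)/(k+1)^2 summable; along all n they are only of
    order 1/n. *)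
Let dev k x : R := ((S (k.+1 ^ 2) x - (k.+1 ^ 2)%:R * q) / (k.+1 ^ 2)%:R) ^+ 2.

Let integral_dev_series : (\int[P]_x (\sum_(k <oo) (dev k x)%:E) < +oo)%E.
Proof.
have q0 : 0 <= q by rewrite -lee_fin -(PW 0).
have q1 : q <= 1 by rewrite -lee_fin -(PW 0) probability_le1.
have qq : 0 <= q - q ^+ 2 by nra.
have devE k : (\int[P]_x (dev k x)%:E =
    ((q - q ^+ 2) / (k.+1 ^ 2)%:R)%:E)%E.
  under eq_integral do rewrite /dev expr_div_n mulrC EFinM.
  have n0 : (k.+1 ^ 2)%:R != 0 :> R by rewrite pnatr_eq0.
  rewrite ge0_integralZl_EFin//; last 2 first.
  - by move=> x _; rewrite lee_fin sqr_ge0.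
  - apply: (@mSE _ (fun y => (y - (k.+1 ^ 2)%:R * q) ^+ 2)).
    by apply: measurable_funX; exact: measurable_funB.
  rewrite integral_dev -EFinM; congr EFin.
  by move: (k.+1 ^ 2)%:R n0 => y y0; field.
rewrite integral_nneseries//; last 2 first.
- move=> k; apply: (@mSE _ (fun y => ((y - (k.+1 ^ 2)%:R * q) / (k.+1 ^ 2)%:R) ^+ 2)).
  by apply: measurable_funX; apply: measurable_funM => //; exact: measurable_funB.
- by move=> k x _; rewrite lee_fin sqr_ge0.
under eq_eseriesr do rewrite devE.
apply: (@le_lt_trans _ _ 2%:E); last exact: ltry.
(* Telescoping: as q - q^2 <= 1/2, each term (q - q^2)/x^2 with x >= 1 is at most 1/(x(x+1)) = 1/x -
   1/(x+1). *)
have bnd n : \sum_(0 <= k < n) (q - q ^+ 2) / (k.+1 ^ 2)%:R <= 2 - n.+1%:R^-1 :> R.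
  elim: n => [|n IH]; first by rewrite big_geq// invr1; lra.
  rewrite big_nat_recr//=; apply: (le_trans (lerD IH (lexx _))).
  have x1 : (1 : R) <= n.+1%:R by rewrite ler1n.
  rewrite -[n.+2]addn1 natrD natrX.
  move: (n.+1%:R : R) x1 => x x1.
  have -> : 2 - (x + 1)^-1 = 2 - x^-1 + (x * (x + 1))^-1.
    by field; rewrite !lt0r_neq0//; lra.
  have qq4 : q - q ^+ 2 <= 2^-1 by nra.
  rewrite lerD2l ler_pdivrMr ?exprn_gt0 1?mulrC ?ler_pdivlMr ?mulr_gt0; nra.
apply: lime_le; first by apply: is_cvg_nneseries => k _ _; rewrite lee_fin divr_ge0.
apply: nearW => n; rewrite sumEFin lee_fin (le_trans (bnd n))//.
by rewrite gerBl invr_ge0.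
Qed.

(** The sum of the [dev k] has a finite integral, hence is finite almost everywhere, and its terms
    tend to 0; this replaces a Borel-Cantelli argument. *)
Lemma slln_indic :
  {ae P, forall x, (fun n => (\sum_(i < n) \1_(W i) x) / n%:R) @ \oo --> q}.
Proof.
pose g x := (\sum_(k <oo) (dev k x)%:E)%E.
have g0 x : (0 <= g x)%E.
  by apply: nneseries_ge0 => k _ _; rewrite lee_fin sqr_ge0.
have mg : measurable_fun setT g.
  apply: ge0_emeasurable_sum => // [k x _ _|k _]; first by rewrite lee_fin sqr_ge0.
  apply: (@mSE _ (fun y => ((y - (k.+1 ^ 2)%:R * q) / (k.+1 ^ 2)%:R) ^+ 2)).
  by apply: measurable_funX; apply: measurable_funM => //; exact: measurable_funB.
have ig : P.-integrable setT g.
  apply/integrableP; split=> //.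
  by under eq_integral do rewrite gee0_abs//; exact: integral_dev_series.
have := integrable_ae measurableT ig.
apply: filterS => x /(_ I) gfin.
have dev0 : (fun k => dev k x) @ \oo --> (0 : R).
  apply: cvg_series_cvg_0.
  apply: nondecreasing_is_cvgn.
    by apply/nondecreasing_seqP => n; rewrite /series/= big_nat_recr//= lerDl sqr_ge0.
  exists (fine (g x)) => _ [n _ <-].
  rewrite /series/= -lee_fin fineK// -sumEFin.
  by apply: nneseries_lim_ge => k _ _; rewrite lee_fin sqr_ge0.
apply: cvg_average_squares => [i|].
  rewrite [X in X - _]big_ord_recr/= addrAC subrr add0r indicE.
  by case: (_ \in _); rewrite /= lexx ler01.
apply/cvgrPdist_lt => eps eps0; near=> k.
have : `|dev k x| < eps ^+ 2.
  near: k; apply: cvgr0_norm_lt => //; exact: exprn_gt0.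
rewrite /dev normrX ltr_pXn2r// ?nnegrE ?ltW// distrC => h.
apply: le_lt_trans h; rewrite mulrBl mulrAC divff ?mul1r// pnatr_eq0//.
Unshelve. all: by end_near.
Qed.
End Slln.

(** [mu] may be infinite off [B], so the strong law is applied to its restriction to [B], a
    probability; an exceptional set of the restriction becomes [mu]-null once intersected with
    [B]. *)
Lemma slln_indic_on (R : realType) (d : measure_display) (T : measurableType d)
    (mu : {measure set T -> \bar R}) (B : set T) (W : nat -> set T) (q : R) :
  measurable B -> mu B = 1%E ->
  (forall i, measurable (W i)) -> (forall i, W i `<=` B) ->
  (forall i, mu (W i) = q%:E) ->
  (forall i j, i <> j -> mu (W i `&` W j) = (q ^+ 2)%:E) ->
  {ae mu, forall x, B x ->
    (fun n => (\sum_(i < n) \1_(W i) x) / n%:R) @ \oo --> q}.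
Proof.
move=> mB muB mW WB PW PWI.
have nuT : mrestr mu mB setT = 1%E by rewrite /mrestr setTI.
pose nu : probability T R :=
  HB.pack (mrestr mu mB) (Measure_isProbability.Build d T R (mrestr mu mB) nuT).
have nuE A : A `<=` B -> nu A = mu A by move=> AB; rewrite /= /mrestr (setIidl AB).
have [||A [mA A0 sA]] := @slln_indic _ _ _ nu W q mW.
- by move=> i; rewrite -(PW i); exact: nuE.
- by move=> i j ij; rewrite -(PWI i j ij); apply: nuE => x [/WB].
exists (A `&` B); split => //; first exact: measurableI.
move=> x /= xB; split; last by apply: contrapT => h; apply: xB.
by apply: sA => /= h; apply: xB.
Qed.

(** * Non-archimedean absolute values *)

Lemma expz_small (R : realType) (c eps : R) : 1 < c -> 0 < eps ->
  exists k : nat, c ^ (- k%:Z) < eps.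
Proof.
move=> c1 eps0; have c0 : 0 <= c^-1 by rewrite invr_ge0 (le_trans ler01)// ltW.
have : (fun n => c^-1 ^+ n) @ \oo --> (0 : R).
  by apply: cvg_expr; rewrite ger0_norm// invf_lt1// (lt_trans ltr01).
move=> /cvgr0_norm_lt/(_ _ eps0)[k _ /(_ k (leqnn k))]/=.
by rewrite ger0_norm ?exprn_ge0// exprVn exprnN => ck; exists k.
Qed.

Lemma fin_argmax (R : realType) (I : finType) (i0 : I) (g : I -> R) :
  exists i, forall j, g j <= g i.
Proof. by exists [arg max_(i > i0) g i]%O; case: arg_maxP => // i _ h j; exact: h. Qed.

Section AbsoluteValue.
Context (R : realType) (K : fieldType) (abs : K -> R).
Hypothesis absP : absolute_value abs.

Lemma abs_ge0 x : 0 <= abs x.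
Proof. by case: absP => + _ _ _; exact. Qed.

Lemma abs_eq0 x : (abs x == 0) = (x == 0).
Proof. by case: absP => _ h _ _; apply/eqP/eqP => /h. Qed.

Lemma abs0 : abs 0 = 0.
Proof. by apply/eqP; rewrite abs_eq0. Qed.

Lemma abs_gt0 x : (0 < abs x) = (x != 0).
Proof. by rewrite lt0r abs_eq0 abs_ge0 andbT. Qed.

Lemma absM x y : abs (x * y) = abs x * abs y.
Proof. by case: absP => _ _ + _; exact. Qed.

Lemma abs1 : abs 1 = 1.
Proof.
have n0 : abs 1 != 0 by rewrite abs_eq0 oner_eq0.
by apply: (mulfI n0); rewrite -absM !mulr1.
Qed.

Lemma absN x : abs (- x) = abs x.
Proof.
suff N1 : abs (- 1) = 1 by rewrite -mulN1r absM N1 mul1r.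
have : abs (- 1) ^+ 2 == 1 by rewrite expr2 -absM mulrNN mulr1 abs1.
rewrite sqrf_eq1 => /orP[/eqP//|/eqP N1].
by have := abs_ge0 (- 1); rewrite N1 oppr_ge0 ler10.
Qed.

Lemma abs_subC x y : abs (x - y) = abs (y - x).
Proof. by rewrite -absN opprB. Qed.

Lemma absV x : abs x^-1 = (abs x)^-1.
Proof.
have [->|x0] := eqVneq x 0; first by rewrite invr0 abs0 invr0.
apply: (mulfI (x := abs x)); first by rewrite abs_eq0.
by rewrite -absM !divff ?abs_eq0// abs1.
Qed.

Lemma absX x n : abs (x ^+ n) = abs x ^+ n.
Proof. by elim: n => [|n IH]; rewrite ?expr0 ?abs1// !exprS absM IH. Qed.

Lemma absXz x (k : int) : abs (x ^ k) = abs x ^ k.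
Proof. by case: k => n; rewrite ?NegzE -?exprnN -?exprnP ?absV absX. Qed.

Hypothesis ultra : forall x y, abs (x + y) <= Num.max (abs x) (abs y).

Lemma absD_le (c : R) x y : abs x <= c -> abs y <= c -> abs (x + y) <= c.
Proof. by move=> xc yc; rewrite (le_trans (ultra _ _))// ge_max xc. Qed.

Lemma absB_le (c : R) x y : abs x <= c -> abs y <= c -> abs (x - y) <= c.
Proof. by move=> xc yc; rewrite absD_le ?absN. Qed.

Lemma absD_lt (c : R) x y : abs x < c -> abs y < c -> abs (x + y) < c.
Proof. by move=> xc yc; rewrite (le_lt_trans (ultra _ _))// gt_max xc. Qed.

Lemma absB_lt (c : R) x y : abs x < c -> abs y < c -> abs (x - y) < c.
Proof. by move=> xc yc; rewrite absD_lt ?absN. Qed.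

Lemma abs_trans (c : R) y x z : abs (x - y) < c -> abs (y - z) < c ->
  abs (x - z) < c.
Proof. by move=> xy yz; rewrite -(subrKA y) absD_lt. Qed.

Lemma abs_sum_le (c : R) (I : Type) (r : seq I) (P : pred I) (F : I -> K) :
  0 <= c -> (forall i, P i -> abs (F i) <= c) ->
  abs (\sum_(i <- r | P i) F i) <= c.
Proof.
move=> c0 Fc; elim/big_ind : _ => //; first by rewrite abs0.
by move=> x y; exact: absD_le.
Qed.

Lemma abs_sum_lt (c : R) (I : Type) (r : seq I) (P : pred I) (F : I -> K) :
  0 < c -> (forall i, P i -> abs (F i) < c) ->
  abs (\sum_(i <- r | P i) F i) < c.
Proof.
move=> c0 Fc; elim/big_ind : _ => //; first by rewrite abs0.
by move=> x y; exact: absD_lt.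
Qed.

(** Triangles are isosceles: if also |x| < |y|, then y = x - (x - y) would be smaller than
    itself. *)
Lemma abs_eq x y : abs (x - y) < abs y -> abs x = abs y.
Proof.
move=> xy; apply/le_anti/andP; split.
  by rewrite -(subrK y x) absD_le// ltW.
rewrite leNgt; apply/negP => lt.
by have := absB_lt lt xy; rewrite subKr ltxx.
Qed.

(** The largest term strictly dominates all others, so the sum has its absolute value. Zero terms
    are exempt from distinctness. *)
Lemma abs_sum_distinct (I : finType) (y : I -> K) :
  (forall i j, y i != 0 -> y j != 0 -> abs (y i) = abs (y j) -> i = j) ->
  forall i, abs (y i) <= abs (\sum_i y i).
Proof.
move=> y_inj i; have [m y_max] := fin_argmax i (fun i => abs (y i)).
apply: le_trans (y_max i) _.
have [->|ym0] := eqVneq (y m) 0; first by rewrite abs0 abs_ge0.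
suff /abs_eq -> : abs (\sum_i y i - y m) < abs (y m) by [].
rewrite (bigD1 m)//= addrAC subrr add0r; apply: abs_sum_lt => [|j jm].
  by rewrite abs_gt0.
rewrite lt_neqAle y_max andbT; apply: contraNneq jm => yjm.
by apply/eqP/y_inj => //; rewrite -abs_eq0 yjm abs_eq0.
Qed.

End AbsoluteValue.

(** * The continued fraction map and Haar measure *)

Lemma measure_fin_bigcup_const (R : realType) (d : measure_display)
    (X : measurableType d) (mu : {measure set X -> \bar R}) (I : finType)
    (J : set I) (F : I -> set X) (c : R) :
  (forall i, J i -> measurable (F i)) -> (forall i, J i -> mu (F i) = c%:E) ->
  (forall i j x, J i -> J j -> F i x -> F j x -> i = j) ->
  mu (\bigcup_(i in J) F i) = (#|[pred i | `[< J i >]]|%:R * c)%:E.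
Proof.
move=> mF Fc tF; have fJ : finite_set J by exact: finite_finset.
rewrite measure_fin_bigcup//; last by move=> i j Ji Jj [x []]; exact: tF.
rewrite fsbig_finite//=; apply: etrans; first exact: (big_uniq _ (finmap.fset_uniq _)).
rewrite mulr_natl -sumr_const -sumEFin.
apply: eq_big => [i|i]; first by rewrite inE in_fset_set// inE.
by rewrite in_fset_set// inE => /Fc.
Qed.

Section Dynamics.
Context (R : realType) (K : fieldType) (abs : K -> R).
Hypothesis absP : absolute_value abs.
Hypothesis ultra : forall x y, abs (x + y) <= Num.max (abs x) (abs y).
Context (beta : K).
Local Notation b := (abs beta).
Hypothesis b_gt1 : 1 < b.
Hypothesis abs_value : forall x, x != 0 -> exists k : int, abs x = b ^ k.
(** [D] indexes the residue field, with representatives [res]. The measure theory sees the floor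
    only through the abstract [fl] below, whatever its construction. *)
Context (D : finType) (res : D -> K).
Hypothesis res_le1 : forall d, abs (res d) <= 1.
Hypothesis res_surj : forall x, abs x <= 1 -> exists d, abs (x - res d) < 1.
Hypothesis res_inj : forall c d, abs (res c - res d) < 1 -> c = d.
Context (fl : K -> K).
Hypothesis flP : forall x, abs (x - fl x) < 1.
Hypothesis fl_eq : forall x y, abs (x - y) < 1 -> fl x = fl y.
Context (mu : {measure set (borel_space abs) -> \bar R}).
Hypothesis muP : is_haar_measure mu.
Hypothesis mu_norm : mu (abs_ball abs 0 1) = 1%E.

(** * Haar measure of balls *)

Let Q : R := #|D|%:R.

Let b_gt0 : 0 < b. Proof. exact: lt_trans b_gt1. Qed.
Let b_neq0 : b != 0. Proof. by rewrite gt_eqF. Qed.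
Let beta_neq0 : beta != 0. Proof. by rewrite -(abs_gt0 absP). Qed.
Let bz_gt0 (k : int) : 0 < b ^ k. Proof. exact: exprz_gt0. Qed.

Local Notation bball z k := (abs_ball abs z (b ^ (- k%R)) : set (borel_space abs)).

Let lt_val x (k : int) : (abs x < b ^ (- k)) = (abs x <= b ^ (- (k + 1))).
Proof.
have [->|/abs_value[j ->]] := eqVneq x 0.
  by rewrite (abs0 absP) bz_gt0 ltW.
by rewrite ler_eXz2l// ltr_eXz2l//; lia.
Qed.

Let Q_gt1 : 1 < Q.
Proof.
have [c0 h0] : exists d, abs (0 - res d) < 1.
  by apply: res_surj; rewrite (abs0 absP) ler01.
have [c1 h1] : exists d, abs (1 - res d) < 1.
  by apply: res_surj; rewrite (abs1 absP).
rewrite /Q ltr1n; apply/card_gt1P; exists c0, c1; split=> //.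
apply/eqP => c01; rewrite c01 in h0.
have := absB_lt absP ultra h1 h0.
by rewrite opprB subr0 subrK (abs1 absP) ltxx.
Qed.

Let Q_gt0 : 0 < Q. Proof. exact: lt_trans Q_gt1. Qed.
Let Q_neq0 : Q != 0. Proof. by rewrite gt_eqF. Qed.

Let open_ball z (r : R) : @open (abs_space abs) (abs_ball abs z r).
Proof.
move=> x; rewrite /abs_ball/= => xz; exists r.
  exact: le_lt_trans (abs_ge0 absP _) xz.
by move=> y /= yx; exact: (abs_trans ultra yx xz).
Qed.

Let open_measurable (A : set (abs_space abs)) :
  open A -> measurable (A : set (borel_space abs)).
Proof. by move=> oA; exact: sub_sigma_algebra. Qed.

Let m_ball z r : measurable (abs_ball abs z r : set (borel_space abs)).
Proof. by apply: open_measurable; exact: open_ball. Qed.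

Let mu_translate (c : K) (A : set (borel_space abs)) :
  measurable A -> mu [set c + x | x in (A : set K)] = mu A.
Proof. by case: muP => h _ _; exact: h. Qed.

Let mu_ball_center z (k : int) : mu (bball z k) = mu (bball 0 k).
Proof.
rewrite -[RHS](mu_translate z)//; congr (mu _).
apply/seteqP; split => [x zx|_ [x x0 <-]].
  by exists (x - z); rewrite ?subrKC// /abs_ball/= subr0.
by move: x0; rewrite /abs_ball/= subr0 addrAC subrr add0r.
Qed.

(** The open ball of radius b^-k is the closed ball of radius b^-(k+1), so this power of [beta]
    scales the residue representatives to its representatives modulo the open ball of radius
    b^-(k+1). *)
Let lift (k : int) d : K := res d * beta ^ (- (k + 1)).

Let lift_surj (k : int) x : abs x < b ^ (- k) ->
  exists d, abs (x - lift k d) < b ^ (- (k + 1)).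
Proof.
rewrite lt_val => xk.
have [|d xd] := @res_surj (x / beta ^ (- (k + 1))).
  by rewrite (absM absP) (absV absP) (absXz absP) ler_pdivrMr ?mul1r.
exists d; rewrite /lift.
rewrite -[x in x - _](divfK (expfz_neq0 (- (k + 1)) beta_neq0)) -mulrBl.
by rewrite (absM absP) (absXz absP) gtr_pMl.
Qed.

Let lift_lt (k : int) d : abs (lift k d) < b ^ (- k).
Proof. by rewrite lt_val (absM absP) (absXz absP) ger_pMl. Qed.

Let lift_inj (k : int) c d : abs (lift k c - lift k d) < b ^ (- (k + 1)) -> c = d.
Proof.
by rewrite -mulrBl (absM absP) (absXz absP) gtr_pMl// => /res_inj.
Qed.

Let mu_ball_step (k : int) (c : R) :
  mu (bball 0 (k + 1)) = c%:E -> mu (bball 0 k) = (Q * c)%:E.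
Proof.
move=> muc.
have -> : bball 0 k = \bigcup_(d in setT) bball (lift k d) (k + 1).
  apply/seteqP; split => [x|x [d _]]; rewrite /abs_ball/= subr0.
    by move=> /lift_surj[d xd]; exists d.
  move=> xd; rewrite -[x](subrK (lift k d)); apply: (absD_lt ultra) => //.
  by rewrite lt_val ltW.
rewrite (measure_fin_bigcup_const (c := c)) => //.
- by rewrite /Q; congr (_%:R * _)%:E; apply: eq_card => i; rewrite !inE asboolT.
- by move=> d _; rewrite mu_ball_center.
- move=> i j x _ _; rewrite /abs_ball/= (abs_subC absP) => xi xj.
  exact: lift_inj (abs_trans ultra xi xj).
Qed.

(** Induction away from radius 1 in both directions. Towards smaller balls the measure must first be
    known to be finite, which monotonicity gives, before the step can be solved for it. *)
Let mu_ball z (k : int) : mu (bball z k) = (Q ^ (- k))%:E.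
Proof.
rewrite mu_ball_center; case: k => n.
  elim: n => [|n IH]; first by rewrite oppr0 !expr0z.
  have fin : mu (bball 0 (n%:Z + 1)) \is a fin_num.
    rewrite ge0_fin_numE// (@le_lt_trans _ _ (mu (bball 0 n%:Z)))//; last first.
      by rewrite IH ltry.
    apply: le_measure; rewrite ?inE// => x; rewrite /abs_ball/= => /lt_le_trans.
    by apply; rewrite ler_eXz2l//; lia.
  have := mu_ball_step (esym (fineK fin)); rewrite IH => -[QE].
  have -> : n.+1%:Z = n%:Z + 1 by lia.
  rewrite -(fineK fin); congr EFin.
  apply: (mulfI Q_neq0); rewrite -QE -[X in X * _]expr1z -expfzDr//.
  by congr (_ ^ _); lia.
rewrite NegzE; elim: n => [|n IH].
  by rewrite (@mu_ball_step _ 1) ?mulr1 ?expr1z// addNr oppr0 expr0z.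
rewrite (@mu_ball_step _ (Q ^ n.+1%:Z)); first by rewrite -exprSz opprK.
by rewrite (_ : - n.+2%:Z + 1 = - n.+1%:Z) ?IH ?opprK//; lia.
Qed.

(** Each of the n refinements adds one digit [lift k d] to every center. *)
Let ball_reps (s : int) (n : nat) : exists (I : finType) (r : I -> K),
  (forall x, bball 0 s x -> exists i, bball (r i) (s + n%:Z) x) /\
  (forall i j x, bball (r i) (s + n%:Z) x -> bball (r j) (s + n%:Z) x -> i = j).
Proof.
elim: n => [|n [I [r [r_surj r_inj]]]].
  exists unit, (fun=> 0); split=> [x|[] []//].
  by rewrite addr0 => ?; exists tt.
have -> : s + n.+1%:Z = s + n%:Z + 1 by lia.
move: (s + n%:Z) r_surj r_inj => k r_surj r_inj.
exists (I * D)%type, (fun id => r id.1 + lift k id.2); split=> [x|].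
  move=> /r_surj[i]; rewrite /abs_ball/= => /lift_surj[d xd].
  by exists (i, d); rewrite /= opprD addrA.
have wide i d x : abs (x - (r i + lift k d)) < b ^ (- (k + 1)) ->
    abs (x - r i) < b ^ (- k).
  move=> xd; rewrite -[x - _](subrK (lift k d)); apply: (absD_lt ultra) => //.
  by rewrite lt_val ltW// -addrA -opprD.
move=> [i c] [j d] x; rewrite /abs_ball/= => xi xj.
have ij : i = j by apply: (r_inj _ _ x); apply: wide; [exact: xi|exact: xj].
rewrite {}ij in xi *; congr (_, _); apply: (@lift_inj k).
rewrite (abs_subC absP) in xi.
have := abs_trans ultra xi xj.
by rewrite opprD addrACA subrr add0r.
Qed.

(** * Inversion and Haar measure *)

Let inv_dist (l : int) x y : abs x = b ^ l -> abs y = b ^ l ->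
  abs (x^-1 - y^-1) = abs (x - y) * b ^ (- (2 * l)).
Proof.
move=> xl yl; have x0 : x != 0 by rewrite -(abs_gt0 absP) xl.
have y0 : y != 0 by rewrite -(abs_gt0 absP) yl.
have -> : x^-1 - y^-1 = (y - x) * (x^-1 * y^-1) by field; rewrite x0 y0.
rewrite !(absM absP) !(absV absP) (abs_subC absP) xl yl -invfM -expfzDr//.
by rewrite invr_expz (_ : l + l = 2 * l)//; ring.
Qed.

(** As k and l are natural numbers, the ball around [r] stays on the sphere of radius b^l, where
    inversion scales all distances by b^(-2l). *)
Let inv_ball (l k : nat) r y : abs r = b ^ l%:Z ->
  bball r k%:Z y^-1 <-> bball r^-1 (k%:Z + 2 * l%:Z) y.
Proof.
move=> rl.
have key z : abs z = b ^ l%:Z ->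
    (abs (z - r) < b ^ (- k%:Z)) = (abs (z^-1 - r^-1) < b ^ (- (k%:Z + 2 * l%:Z))).
  by move=> zl; rewrite (inv_dist zl rl) opprD expfzDr// ltr_pM2r.
rewrite /abs_ball/=; split => h.
  have yl : abs y^-1 = b ^ l%:Z.
    rewrite -rl; apply: (abs_eq absP ultra); apply: lt_le_trans h _.
    by rewrite rl ler_eXz2l//; lia.
  by rewrite key// invrK in h.
have yl : abs y^-1 = b ^ l%:Z.
  rewrite (absV absP) (@abs_eq _ _ _ absP ultra y r^-1).
    by rewrite (absV absP) rl invrK.
  by apply: lt_le_trans h _; rewrite (absV absP) rl invr_expz ler_eXz2l//; lia.
by rewrite key// invrK.
Qed.

Let small_radius (eps : R) : 0 < eps -> exists k : nat, b ^ (- k%:Z) < eps.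
Proof. exact: expz_small. Qed.

Let inv_open (l : nat) (A : set K) : @open (abs_space abs) A ->
  (forall x, A x -> abs x = b ^ l%:Z) -> @open (abs_space abs) [set x | A x^-1].
Proof.
move=> oA Al; suff : abs_open abs [set x | A x^-1] by [].
move=> x Ax; have [r r0 rA] := oA _ Ax.
have [k kr] := small_radius r0; exists (b ^ (- (k%:Z + 2 * l%:Z))) => // y.
rewrite -[x]invrK => /(inv_ball _ _ (Al _ Ax)) ky.
by apply: rA; exact: lt_trans ky kr.
Qed.

(* A is the increasing union of the sets [A_ k] of centers of balls of radius
   b^-k contained in A. Each [A_ k] is a finite union of such balls, and
   inversion maps them to balls of radius b^(-k-2l). *)
Let inv_measure (l : nat) (A : set K) : @open (abs_space abs) A ->
  (forall x, A x -> abs x = b ^ l%:Z) ->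
  mu ([set x | A x^-1] : set (borel_space abs)) = ((Q ^ (- (2 * l%:Z)))%:E * mu A)%E.
Proof.
move=> oA Al.
pose A_ (k : nat) : set (borel_space abs) := [set x | bball x k%:Z `<=` A].
have A_sub k x y : A_ k x -> bball x k%:Z y -> A_ k y.
  move=> xA xy z yz; apply: xA; move: xy yz; rewrite /abs_ball/= => xy yz.
  exact: (abs_trans ultra yz xy).
have A_oA k : open (A_ k : set (abs_space abs)).
  by move=> x xA; exists (b ^ (- k%:Z)) => // y; exact: A_sub.
have A_A k : A_ k `<=` A.
  by move=> x; apply; rewrite /abs_ball/= subrr (abs0 absP).
have UA : \bigcup_k A_ k = A.
  apply/seteqP; split => [x [k _ /A_A]//|x Ax].
  have [r r0 rA] := oA _ Ax; have [k kr] := small_radius r0.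
  by exists k => // y; rewrite /abs_ball/= => xy; apply: rA; exact: lt_trans xy kr.
have ndA : nondecreasing_seq A_.
  apply/nondecreasing_seqP => k; apply/subsetPset => x xA y xy; apply: xA.
  by move: xy; rewrite /abs_ball/= => /lt_le_trans; apply; rewrite ler_eXz2l//; lia.
pose V k : set (borel_space abs) := [set x | A_ k x^-1].
have VE k : mu (V k) = ((Q ^ (- (2 * l%:Z)))%:E * mu (A_ k))%E.
  (* The open ball of radius b^(l+1) contains the sphere of radius b^l; after k + l + 1 refinements
     the radius is b^-k. *)
  have [I [r [r_surj r_inj]]] := ball_reps (- (l%:Z + 1)) (k + l + 1).
  have kE : - (l%:Z + 1) + (k + l + 1)%N%:Z = k%:Z by lia.
  rewrite {}kE in r_surj r_inj; pose J := [set i | A_ k (r i)].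
  have AE : A_ k = \bigcup_(i in J) bball (r i) k%:Z.
    apply/seteqP; split => [x Akx|x [i Ji]]; last exact: A_sub.
    have [|i xi] := r_surj x.
      by rewrite /abs_ball/= subr0 (Al _ (A_A _ _ Akx)) opprK ltr_eXz2l//; lia.
    exists i => //; apply: A_sub Akx _.
    by rewrite /abs_ball/= (abs_subC absP).
  have Jl i : J i -> abs (r i) = b ^ l%:Z by move=> /A_A/Al.
  have VkE : V k = \bigcup_(i in J) bball (r i)^-1 (k%:Z + 2 * l%:Z).
    rewrite /V AE; apply/seteqP; split => x [i Ji] xi; exists i => //.
      exact/inv_ball/xi/Jl.
    exact/(inv_ball _ _ (Jl _ Ji))/xi.
  rewrite VkE (measure_fin_bigcup_const (c := Q ^ (- (k%:Z + 2 * l%:Z)))) => //.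
  - rewrite AE (measure_fin_bigcup_const (c := Q ^ (- k%:Z))) => //.
    by rewrite -EFinM; congr EFin; rewrite opprD expfzDr//; ring.
    by move=> i j x _ _; exact: r_inj.
  - move=> i j x Ji Jj /(inv_ball _ _ (Jl _ Ji)) xi /(inv_ball _ _ (Jl _ Jj)) xj.
    exact: r_inj xi xj.
have oV k : open (V k : set (abs_space abs)).
  by apply: (inv_open (l := l) (A_oA k)) => x /A_A/Al.
have UV : \bigcup_k V k = [set x | A x^-1].
  by rewrite -UA; apply/seteqP; split => x [k _ xk]; exists k.
have ndV : nondecreasing_seq V.
  by move=> i j /ndA/subsetPset AA; apply/subsetPset => x; exact: AA.
have cV : mu \o V @ \oo --> mu [set x | A x^-1].
  rewrite -UV; apply: nondecreasing_cvg_mu => //.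
    by move=> k; apply: open_measurable.
  by apply: bigcup_measurable => k _; apply: open_measurable.
have cA : mu \o A_ @ \oo --> mu A.
  rewrite -UA; apply: nondecreasing_cvg_mu => //.
    by move=> k; apply: open_measurable.
  by apply: bigcup_measurable => k _; apply: open_measurable.
apply: (cvg_unique _ cV) => //.
rewrite (_ : mu \o V = fun k => (Q ^ (- (2 * l%:Z)))%:E * mu (A_ k))%E; last first.
  by apply/funext => k; exact: VE.
exact: cvgeZl.
Qed.

(** * The continued fraction map on the spheres *)

Local Notation B := (abs_ball abs 0 1 : set (borel_space abs)).

Let BE x : B x = (abs x < 1) :> Prop. Proof. by rewrite /abs_ball/= subr0. Qed.

(** Convertible to [cf_map] when [fl] is [ext_floor]. *)
Definition gauss (x : K) : K := if x == 0 then 0 else x^-1 - fl x^-1.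

Let gauss_lt1 x : abs (gauss x) < 1.
Proof. by rewrite /gauss; case: ifP => _ //; rewrite (abs0 absP). Qed.

(* Indexed from 0: [shell l] is where the first partial quotient has absolute
   value b^(l+1). *)
Definition shell (l : nat) : set (borel_space abs) := [set x | abs x = b ^ (- l.+1%:Z)].

Let shell_neq0 l x : shell l x -> x != 0.
Proof. by rewrite /shell/= -(abs_gt0 absP) => ->. Qed.

Let shell_open l : @open (abs_space abs) (shell l).
Proof.
suff : abs_open abs (shell l) by [].
move=> x xl; exists (b ^ (- l.+1%:Z)) => // y; rewrite /abs_ball/= -xl => yx.
by rewrite /shell/= -xl; exact: (abs_eq absP ultra yx).
Qed.

Let mu_fin (A : set (borel_space abs)) : @open (abs_space abs) A -> A `<=` B ->
  mu A \is a fin_num.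
Proof.
move=> oA AB; have mA := open_measurable oA.
rewrite ge0_fin_numE// (@le_lt_trans _ _ (mu B))//; last by rewrite mu_norm ltry.
by apply: le_measure; rewrite ?inE.
Qed.

(* The number of branches over a shell is never computed: it enters both sides,
   and A = B identifies the constant as the measure of the shell. *)
Let shell_gauss l : forall A : set (borel_space abs),
  @open (abs_space abs) A -> A `<=` B ->
  @open (abs_space abs) (shell l `&` gauss @^-1` A) /\
  mu (shell l `&` gauss @^-1` A) = (mu (shell l) * mu A)%E.
Proof.
(* The final radius is 1: the ball of radius b^(l+2), which contains the reciprocals of the shell,
   is cut into cosets of the open unit ball. *)
have [I [r [r_surj r_inj]]] := ball_reps (- l.+2%:Z) l.+2.
rewrite addNr in r_surj r_inj.
pose J := [set i | abs (r i) = b ^ l.+1%:Z].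
(* These will be the reciprocals of the points of the shell that [gauss] sends into [A]: one copy of
   [A] at each floor value of absolute value b^(l+1). *)
pose G (A : set K) : set (borel_space abs) :=
  \bigcup_(i in J) [set fl (r i) + x | x in A].
have shiftE i (A : set K) y : [set fl (r i) + x | x in A] y <-> A (y - fl (r i)).
  split=> [[x Ax <-]|Ay]; first by rewrite addrAC subrr add0r.
  by exists (y - fl (r i)) => //; rewrite subrKC.
have shift_near i (A : set (borel_space abs)) y : A `<=` B ->
    [set fl (r i) + x | x in (A : set K)] y -> abs (y - r i) < 1.
  move=> AB /shiftE/AB; rewrite BE => h; apply: (abs_trans ultra h).
  by rewrite (abs_subC absP).
have GE (A : set (borel_space abs)) : A `<=` B ->
    shell l `&` gauss @^-1` A = [set x | G A x^-1].
  move=> AB; apply/seteqP; split => [x [xl Ax]|x [i Ji] Ax].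
    have xl' : abs x^-1 = b ^ l.+1%:Z by rewrite (absV absP) xl invr_expz opprK.
    have [|i] := r_surj x^-1.
      by rewrite /abs_ball/= subr0 xl' opprK ltr_eXz2l//; lia.
    rewrite /abs_ball/= oppr0 expr0z => xi.
    exists i.
      rewrite /J/= -xl'; apply: (abs_eq absP ultra).
      rewrite (abs_subC absP) (lt_le_trans xi)// xl'.
      by rewrite -[1](expr0z b) ler_eXz2l//; lia.
    apply/shiftE; rewrite -(fl_eq xi).
    by move: Ax; rewrite /= /gauss (negPf (shell_neq0 xl)).
  have xi := shift_near _ _ _ AB Ax.
  have xl : abs x^-1 = b ^ l.+1%:Z.
    rewrite -Ji; apply: (abs_eq absP ultra); rewrite (lt_le_trans xi)// Ji.
    by rewrite -[1](expr0z b) ler_eXz2l//; lia.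
  have xl' : shell l x by rewrite /shell/= -[x]invrK (absV absP) xl invr_expz.
  split=> //; rewrite /= /gauss (negPf (shell_neq0 xl')) (fl_eq xi).
  exact/shiftE.
have G_sphere (A : set (borel_space abs)) : A `<=` B ->
    forall x, G A x -> abs x = b ^ l.+1%:Z.
  move=> AB x [i Ji] Ax; rewrite -Ji; apply: (abs_eq absP ultra).
  rewrite (lt_le_trans (shift_near _ _ _ AB Ax))// Ji.
  by rewrite -[1](expr0z b) ler_eXz2l//; lia.
have shift_open i (A : set (borel_space abs)) : @open (abs_space abs) A ->
    @open (abs_space abs) [set fl (r i) + x | x in (A : set K)].
  move=> oA; suff : abs_open abs [set fl (r i) + x | x in (A : set K)] by [].
  move=> y /shiftE /oA[e e0 eA]; exists e => // z yz; apply/shiftE; apply: eA.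
  by move: yz; rewrite /abs_ball/= opprB addrA subrK.
have G_open (A : set (borel_space abs)) : @open (abs_space abs) A ->
    @open (abs_space abs) (G A).
  by move=> oA; apply: bigcup_open => i _; exact: shift_open.
have mu_G (A : set (borel_space abs)) : @open (abs_space abs) A -> A `<=` B ->
    mu (shell l `&` gauss @^-1` A) = 
    ((Q ^ (- (2 * l.+1%:Z)) * #|[pred i | `[< J i >]]|%:R)%:E * mu A)%E.
  move=> oA AB; have mA := open_measurable oA.
  rewrite GE// (@inv_measure l.+1)//; [|exact: G_open|exact: G_sphere].
  have finA := mu_fin oA AB.
  rewrite (measure_fin_bigcup_const (c := fine (mu A))).
  - by rewrite -[in RHS](fineK finA) -!EFinM mulrA.
  - by move=> i _; apply: open_measurable; exact: shift_open.
  - by move=> i _; rewrite fineK// mu_translate.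
  - move=> i j x _ _ /(shift_near _ _ _ AB) xi /(shift_near _ _ _ AB) xj.
    by apply: (r_inj _ _ x); rewrite /abs_ball/= oppr0 expr0z.
move=> A oA AB; split.
  by rewrite GE//; apply: (@inv_open l.+1); [exact: G_open|exact: G_sphere].
rewrite mu_G//; congr (_ * _)%E.
have -> : shell l = shell l `&` gauss @^-1` B.
  by apply/seteqP; split => [x xl|x []//]; split => //=; rewrite BE.
rewrite (mu_G _ (@open_ball 0 1) (@subset_refl _ _)).
by rewrite mu_norm mule1.
Qed.

Definition shells (J : set nat) : set (borel_space abs) := \bigcup_(l in J) shell l.

Let shells_open J : @open (abs_space abs) (shells J).
Proof. by apply: bigcup_open => l _; exact: shell_open. Qed.

Let shell_inj x i j : shell i x -> shell j x -> i = j.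
Proof.
by rewrite /shell/= => -> /(ieexprIz b_gt0 (negbT (gt_eqF b_gt1))); lia.
Qed.

Let shellsTE x : shells setT x <-> B x /\ x != 0.
Proof.
rewrite BE; split=> [[l _ xl]|[x1 x0]].
  split; last exact: shell_neq0 xl.
  by rewrite xl -[1](expr0z b) ltr_eXz2l.
have [k xk] := abs_value x0; move: x1; rewrite xk -[1](expr0z b) ltr_eXz2l// => k0.
exists `|k|.-1%N => //; rewrite /shell/= xk; congr (_ ^ _); lia.
Qed.

Let shells_ball J : shells J `<=` B.
Proof. by move=> x [l _ xl]; have /shellsTE[] : shells setT x by exists l. Qed.

Let measurable_point : measurable ([set (0 : K)] : set (borel_space abs)).
Proof.
rewrite -(setCK [set _]); apply: measurableC; apply: open_measurable.
suff : abs_open abs (~` [set (0 : K)]) by [].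
move=> x /= /eqP x0; exists (abs x); first by rewrite (abs_gt0 absP).
by move=> y yx /= y0; move: yx; rewrite y0 /abs_ball/= sub0r (absN absP) ltxx.
Qed.

Let mu_point : mu [set (0 : K)] = 0%E.
Proof.
apply/eqP; rewrite eq_le measure_ge0 andbT; apply/lee_addgt0Pr => e e0.
have [k Qk] := expz_small Q_gt1 e0.
rewrite add0e (@le_trans _ _ (mu (bball 0 k%:Z)))//; last first.
  by rewrite mu_ball lee_fin ltW.
apply: le_measure; rewrite ?inE//.
by move=> _ ->; rewrite /abs_ball/= subrr (abs0 absP).
Qed.

Let mu_shellsT : mu (shells setT) = 1%E.
Proof.
rewrite -mu_norm.
have -> : B = shells setT `|` [set (0 : K)].
  apply/seteqP; split=> [x Bx|x [/shells_ball//|->]]; last first.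
    by rewrite BE (abs0 absP).
  by have [->|x0] := eqVneq x 0; [right|left; apply/shellsTE].
apply/esym; apply: measureU0; last exact: mu_point.
  by apply: open_measurable; exact: shells_open.
exact: measurable_point.
Qed.

(** Summed over the shells: [shells J] constrains the first partial quotient only, and [A] the later
    ones, so this is their independence. *)
Let shells_gauss J (A : set (borel_space abs)) :
  @open (abs_space abs) A -> A `<=` B ->
  @open (abs_space abs) (shells J `&` gauss @^-1` A) /\
  mu (shells J `&` gauss @^-1` A) = (mu (shells J) * mu A)%E.
Proof.
move=> oA AB.
have -> : shells J `&` gauss @^-1` A = \bigcup_(l in J) (shell l `&` gauss @^-1` A).
  by rewrite setI_bigcupl.
split; first by apply: bigcup_open => l _; case: (shell_gauss l oA AB).
rewrite !measure_bigcup.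
- under eq_eseriesr => l _.
    have [_ ->] := shell_gauss l oA AB.
    over.
  rewrite (eq_eseriesr (g := fun l => (fine (mu A))%:E * mu (shell l))%E); last first.
    by move=> l _; rewrite fineK ?mu_fin// muleC.
  by rewrite nneseriesZl// fineK ?mu_fin// muleC.
- by move=> l _; apply: open_measurable; exact: shell_open.
- by move=> i j _ _ [x [/shell_inj]]; exact.
- by move=> l _; apply: open_measurable; case: (shell_gauss l oA AB).
- by move=> i j _ _ [x [[/shell_inj + _] [+ _]]]; exact.
Qed.

(** The partial quotient of index n + 1 has absolute value b^(l+1) for some l in [J]. *)
Definition orbit_event (J : set nat) (n : nat) : set (borel_space abs) :=
  [set x | B x /\ shells J (iter n gauss x)].

Let orbit_event0 J : orbit_event J 0 = shells J.
Proof.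
by apply/seteqP; split => [x []//|x xJ]; split => //; exact: shells_ball xJ.
Qed.

(** [gauss] fixes 0, which lies in no shell, so 0 drops out of the preimage. *)
Let gauss_preimage (A : set (borel_space abs)) : A `<=` shells setT ->
  B `&` gauss @^-1` A = shells setT `&` gauss @^-1` A.
Proof.
move=> AS; apply/seteqP; split => x [xB xA]; split => //; last exact: shells_ball xB.
apply/shellsTE; split=> //; apply/eqP => x0.
by move: xA => /AS/shellsTE[_]; rewrite x0 /gauss !eqxx.
Qed.

Let gauss_preserving (A : set (borel_space abs)) :
  @open (abs_space abs) A -> A `<=` shells setT ->
  @open (abs_space abs) (B `&` gauss @^-1` A) /\ mu (B `&` gauss @^-1` A) = mu A.
Proof.
move=> oA AS; rewrite gauss_preimage//.
have [|oS muS] := shells_gauss setT oA; first exact: subset_trans AS (@shells_ball _).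
by rewrite muS mu_shellsT mul1e.
Qed.

Let orbit_eventS J n : orbit_event J n.+1 = B `&` gauss @^-1` orbit_event J n.
Proof.
apply/seteqP; split => x [xB xJ]; split => //; rewrite /orbit_event/= -?iterSr.
  by split=> //; rewrite BE.
by case: xJ => _; rewrite -iterSr.
Qed.

Let orbit_event_open J n : @open (abs_space abs) (orbit_event J n) /\
  orbit_event J n `<=` shells setT.
Proof.
elim: n => [|n [oE EJ]].
  rewrite orbit_event0; split; first exact: shells_open.
  by move=> x [l _ xl]; exists l.
rewrite orbit_eventS gauss_preimage//; split; last by move=> x [].
by have [] := shells_gauss setT oE (subset_trans EJ (@shells_ball _)).
Qed.

Let mu_orbit_event J n : mu (orbit_event J n) = mu (shells J).
Proof.
elim: n => [|n IH]; first by rewrite orbit_event0.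
have [oE EJ] := orbit_event_open J n.
by rewrite orbit_eventS; have [_ ->] := gauss_preserving oE EJ.
Qed.

(** Invariance removes m iterations from both events; the earlier one is then [shells J], and
    [shells_gauss] applies. *)
Let mu_orbit_event2 J m n : (m < n)%N ->
  mu (orbit_event J m `&` orbit_event J n) = (mu (shells J) * mu (shells J))%E.
Proof.
elim: m n => [|m IH] [|n]//; rewrite ?ltnS => mn.
  have [oE EJ] := orbit_event_open J n.
  have EB := subset_trans EJ (@shells_ball _).
  rewrite orbit_event0 orbit_eventS setIA.
  have /setIidl -> := @shells_ball J.
  by have [_ ->] := shells_gauss J oE EB; rewrite mu_orbit_event.
have [oE EJ] := orbit_event_open J m; have [oE' EJ'] := orbit_event_open J n.
rewrite !orbit_eventS setIACA setIid -preimage_setI.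
have [||_ ->] := @gauss_preserving (orbit_event J m `&` orbit_event J n).
- exact: openI.
- by move=> x [/EJ].
exact: IH.
Qed.

(** * Frequencies along a sequence of indices *)

Lemma frequency_orbit (a : nat -> nat) (J : set nat) (q : R) :
  (forall n, (0 < n)%N -> (0 < a n)%N) ->
  (forall i j, (0 < i)%N -> (i < j)%N -> (a i < a j)%N) ->
  mu (shells J) = q%:E ->
  {ae mu, forall x, B x ->
    frequency R (fun j => `[< shells J (iter (a j).-1 gauss x) >]) @ \oo --> q}.
Proof.
move=> a_gt0 a_incr muJ; pose W i := orbit_event J (a i.+1).-1.
(* Since [a] is positive, its predecessors are still strictly increasing, so the two events have
   different times. *)
have W2 i j : (i < j)%N -> mu (W i `&` W j) = (q ^+ 2)%:E.
  move=> ij; rewrite /W mu_orbit_event2 ?muJ//.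
  have := @a_incr i.+1 j.+1 isT ij; have := @a_gt0 i.+1 isT; lia.
have : {ae mu, forall x, B x ->
    (fun n => (\sum_(i < n) \1_(W i) x) / n%:R) @ \oo --> q}.
  apply: slln_indic_on => //.
  - by move=> i; apply: open_measurable; have [] := orbit_event_open J (a i.+1).-1.
  - by move=> i x [].
  - by move=> i; rewrite mu_orbit_event.
  - move=> i j /eqP; rewrite neq_ltn => /orP[/W2//|/W2].
    by rewrite setIC.
apply: filterS => x + xB => /(_ xB).
rewrite (_ : (fun n => _ / _) =
  frequency R (fun j => `[< shells J (iter (a j).-1 gauss x) >]))//.
apply/funext => n; rewrite /frequency; congr (_ / _).
rewrite -[1%N](addn0 1) iotaDl count_map -sum1_count natr_sum.
have -> : iota 0 n = index_iota 0 n by rewrite /index_iota subn0.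
rewrite big_mkord [RHS]big_mkcond; apply: eq_bigr => i _.
rewrite indicE /W -[RHS]mulrb; congr (_%:R); congr nat_of_bool.
apply/idP/asboolP; first by rewrite inE => -[].
by move=> xJ; apply/mem_set.
Qed.

(** Together with the null set of the point 0, these shells fill the ball of radius b^-m. *)
Let mu_shells_ge m : mu (shells [set i | (m <= i)%N]) = (Q ^ (- m%:Z))%:E.
Proof.
rewrite -(mu_ball 0 m).
have -> : bball 0 m%:Z = shells [set i | (m <= i)%N] `|` [set (0 : K)].
  apply/seteqP; split=> x; rewrite /abs_ball/= subr0.
    move=> H; have [->|x0] := eqVneq x 0; [by right|left].
    have [|l _ xl] := (shellsTE x).2.
      by split=> //; rewrite BE (lt_le_trans H)// -[1](expr0z b) ler_eXz2l//; lia.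
    by exists l => //=; move: H; rewrite xl ltr_eXz2l// ltrN2 ltz_nat ltnS.
  case=> [[l /= ml ->]|->]; last by rewrite (abs0 absP).
  by rewrite ltr_eXz2l//; lia.
apply/esym; apply: measureU0; last exact: mu_point.
  by apply: open_measurable; exact: shells_open.
exact: measurable_point.
Qed.

Let mu_shells_ico m n : (m <= n)%N ->
  mu (shells [set i | (m <= i < n)%N]) = (Q ^ (- m%:Z) - Q ^ (- n%:Z))%:E.
Proof.
move=> mn; have := mu_shells_ge m.
have -> : shells [set i | (m <= i)%N] =
    shells [set i | (m <= i < n)%N] `|` shells [set i | (n <= i)%N].
  apply/seteqP; split => x.
    move=> [i /= mi xi]; have [ni|ni] := ltnP i n; [left|right]; exists i => //=.
    by rewrite mi.
  case=> -[i /=]; first by case/andP=> mi _ xi; exists i.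
  by move=> ni xi; exists i => //=; exact: leq_trans ni.
have -> : mu (shells [set i | (m <= i < n)%N] `|` shells [set i | (n <= i)%N]) =
    (mu (shells [set i | (m <= i < n)%N]) + mu (shells [set i | (n <= i)%N]))%E.
  apply: measureU.
  - by apply: open_measurable; exact: shells_open.
  - by apply: open_measurable; exact: shells_open.
  - apply/seteqP; split => // x [[i /= + xi] [j /= + xj]].
    by rewrite (shell_inj xi xj); lia.
rewrite mu_shells_ge => /(congr1 (fun z => z - (Q ^ (- n%:Z))%:E)%E).
by rewrite addeK// => ->.
Qed.

(** The case y = 0 reflects 0^-1 = 0: then [fl 0] lies in the open unit ball, below every threshold
    b^(m+1), in accordance with 0 lying in no shell. *)
Let floor_inv y : abs y < 1 ->
  y = 0 /\ abs (fl y^-1) < 1 \/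
  exists2 l, shell l y & abs (fl y^-1) = b ^+ l.+1.
Proof.
move=> y1; have [->|y0] := eqVneq y 0.
  by left; split=> //; rewrite invr0 -(absN absP) -[- _]add0r.
have [|l _ yl] := (shellsTE y).2; first by rewrite BE.
right; exists l => //.
have yl' : abs y^-1 = b ^+ l.+1 by rewrite (absV absP) yl invr_expz opprK.
rewrite -yl'; apply: (abs_eq absP ultra).
by rewrite (abs_subC absP) (lt_le_trans (flP _))// yl' exprn_ege1// ltW.
Qed.

Let floor_inv_ge y m : abs y < 1 ->
  (b ^+ m.+1 <= abs (fl y^-1)) = `[< shells [set i | (m <= i)%N] y >].
Proof.
have b1 k : 1 <= b ^+ k by rewrite exprn_ege1// ltW.
move=> /floor_inv[[-> h]|[l yl h]].
  rewrite leNgt (lt_le_trans h)//=; apply/esym/asboolP => -[i _ /shell_neq0].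
  by rewrite eqxx.
rewrite h ler_eXn2l//; apply/idP/asboolP => [ml|[i /= mi yi]]; first by exists l.
by rewrite (shell_inj yl yi).
Qed.

Let floor_inv_ico y m n : abs y < 1 ->
  (b ^+ m.+1 <= abs (fl y^-1) < b ^+ n.+1) =
  `[< shells [set i | (m <= i < n)%N] y >].
Proof.
move=> y1; rewrite ltNge !floor_inv_ge//.
apply/andP/asboolP => [[/asboolP[i /= mi yi] /asboolPn ni]|[i /= /andP[mi ni] yi]].
  exists i => //=; rewrite mi ltnNge; apply/negP => ni'; apply: ni; by exists i.
split; first by apply/asboolP; exists i.
by apply/asboolPn => -[j /= nj /(shell_inj yi) ij]; rewrite -ij leqNgt ni in nj.
Qed.

Let floor_inv_eq y m : abs y < 1 ->
  (abs (fl y^-1) == b ^+ m.+1) = `[< shells [set i | (m <= i < m.+1)%N] y >].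
Proof.
move=> y1; rewrite -floor_inv_ico//; have [[_ h]|[l yl ->]] := floor_inv y1.
  have bl : abs (fl y^-1) < b ^+ m.+1 by rewrite (lt_le_trans h)// exprn_ege1// ltW.
  by rewrite (lt_eqF bl) leNgt bl.
rewrite ler_eXn2l// ltr_eXn2l// ltnS -eqn_leq eq_sym.
by rewrite (inj_eq (ieexprIn b_gt0 (negbT (gt_eqF b_gt1)))).
Qed.

Let iter_gauss_lt1 n x : abs x < 1 -> abs (iter n gauss x) < 1.
Proof. by case: n => [//|n] _; rewrite iterS. Qed.

Context (a : nat -> nat).
Hypothesis a_gt0 : forall n, (0 < n)%N -> (0 < a n)%N.
Hypothesis a_incr : forall i j, (0 < i)%N -> (i < j)%N -> (a i < a j)%N.
Local Notation c j x := (fl (iter (a j).-1 gauss x)^-1).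

Let frequency_floor (P : pred R) (J : set nat) (q : R) :
  mu (shells J) = q%:E ->
  (forall y, abs y < 1 -> P (abs (fl y^-1)) = `[< shells J y >]) ->
  {ae mu, forall x, B x -> frequency R (fun j => P (abs (c j x))) @ \oo --> q}.
Proof.
move=> muJ PJ; have := frequency_orbit a_gt0 a_incr muJ.
apply: filterS => x + xB => /(_ xB).
rewrite (_ : frequency R _ = frequency R (fun j => P (abs (c j x))))//.
apply/funext => n; rewrite /frequency; congr (_%:R / _); apply: eq_count => j.
by rewrite PJ// iter_gauss_lt1// -BE.
Qed.

Lemma frequency_floor_eq l : (0 < l)%N ->
  {ae mu, forall x, B x ->
    frequency R (fun j => abs (c j x) == b ^+ l) @ \oo --> (Q - 1) / Q ^+ l}.
Proof.
(* The shell is the difference of the balls of radius b^-l and b^-(l+1). *)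
case: l => // l _; have -> : (Q - 1) / Q ^+ l.+1 = Q ^ (- l%:Z) - Q ^ (- l.+1%:Z).
  by rewrite -!exprnN exprS; field; rewrite Q_neq0 expf_neq0.
apply: (frequency_floor (P := fun r => r == b ^+ l.+1)).
  exact: (mu_shells_ico (leqnSn l)).
by move=> y; exact: floor_inv_eq.
Qed.

Lemma frequency_floor_ge l : (0 < l)%N ->
  {ae mu, forall x, B x ->
    frequency R (fun j => b ^+ l <= abs (c j x)) @ \oo --> 1 / Q ^+ (l - 1)}.
Proof.
case: l => // l _; rewrite div1r subn1 exprnN.
apply: (frequency_floor (P := fun r => b ^+ l.+1 <= r)); first exact: mu_shells_ge.
by move=> y; exact: floor_inv_ge.
Qed.

Lemma frequency_floor_ico k l : (0 < k)%N -> (k < l)%N ->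
  {ae mu, forall x, B x ->
    frequency R (fun j => b ^+ k <= abs (c j x) < b ^+ l) @ \oo -->
    1 / Q ^+ (k - 1) * (1 - 1 / Q ^+ (l - k))}.
Proof.
case: k => // k _; case: l => // l; rewrite ltnS => kl.
have -> : 1 / Q ^+ (k.+1 - 1) * (1 - 1 / Q ^+ (l.+1 - k.+1)) =
    Q ^ (- k%:Z) - Q ^ (- l%:Z).
  rewrite !subSS subn0 -!exprnN -[in RHS](subnKC (ltnW kl)) exprD.
  by field; rewrite !expf_neq0.
apply: (frequency_floor (P := fun r => b ^+ k.+1 <= r < b ^+ l.+1)).
  exact: mu_shells_ico (ltnW kl).
by move=> y; exact: floor_inv_ico.
Qed.

End Dynamics.

(** * The field of p-adic numbers *)

(* v(x+y)^n <= (n+1) max(v x, v y)^n for all n, by the binomial formula. *)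
Lemma absolute_value_ultrametric (R : realType) (F : fieldType) (v : F -> R) :
  absolute_value v -> (forall n : nat, v n%:R <= 1) ->
  forall x y, v (x + y) <= Num.max (v x) (v y).
Proof.
move=> vP v1 x y; rewrite leNgt; apply/negP; set M := Num.max _ _ => Mlt.
have M0 : 0 <= M by rewrite le_max (abs_ge0 vP).
have vsum (I : Type) (r : seq I) (P : pred I) (G : I -> F) :
    v (\sum_(i <- r | P i) G i) <= \sum_(i <- r | P i) v (G i).
  elim/big_ind2 : _ => [|a b c d ab cd|//]; first by rewrite (abs0 vP).
  by case: vP => _ _ _ tri; rewrite (le_trans (tri _ _))// lerD.
have bnd n : v (x + y) ^+ n <= n.+1%:R * M ^+ n.
  rewrite -(absX vP) exprDn (le_trans (vsum _ _ _ _))//.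
  rewrite mulr_natl -[n.+1 in leRHS]card_ord -sumr_const ler_sum// => i _.
  rewrite -mulr_natr !(absM vP) !(absX vP) -[leRHS]mulr1.
  have i_le : (i <= n)%N by rewrite -ltnS.
  rewrite ler_pM ?mulr_ge0 ?exprn_ge0 ?(abs_ge0 vP)//.
  rewrite -[in leRHS](subnK i_le) exprD ler_pM ?exprn_ge0 ?(abs_ge0 vP)//.
    by rewrite lerXn2r ?nnegrE ?(abs_ge0 vP)// le_max lexx.
  by rewrite lerXn2r ?nnegrE ?(abs_ge0 vP)// le_max lexx orbT.
have Mp : 0 < M.
  rewrite lt_neqAle M0 andbT eq_sym; apply/eqP => M00.
  by have := bnd 1%N; rewrite M00 !expr1 mulr0 leNgt -M00 Mlt.
pose dl := v (x + y) / M - 1.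
have dl0 : 0 < dl by rewrite subr_gt0 ltr_pdivlMr ?mul1r.
have {}bnd n : (1 + dl) ^+ n <= n.+1%:R.
  by rewrite /dl subrKC expr_div_n ler_pdivrMr ?exprn_gt0.
have bern k : 1 + k%:R * dl <= (1 + dl) ^+ k.
  elim: k => [|k IH]; first by rewrite mul0r addr0 expr0.
  rewrite exprS -natr1; have k0 : (0 : R) <= k%:R by [].
  move: IH; set E := (1 + dl) ^+ k => IH; nra.
(* By the square of Bernoulli's inequality, (1 + dl)^(2k) >= (1 + k dl)^2 > k^2 dl^2 > 3k >= 2k + 1,
   against [bnd] at 2k. *)
pose k := (Num.trunc (3 / dl ^+ 2)).+1.
have kd : 3 / dl ^+ 2 < k%:R by exact: truncnS_gt.
have k1 : (1 : R) <= k%:R by rewrite ler1n.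
have := bnd (k * 2)%N; rewrite exprM leNgt => /negP; apply.
have : (1 + k%:R * dl) ^+ 2 <= ((1 + dl) ^+ k) ^+ 2.
  have h0 : 0 <= 1 + k%:R * dl by rewrite addr_ge0// mulr_ge0// ltW.
  by rewrite lerXn2r ?nnegrE// (le_trans h0).
apply: lt_le_trans; rewrite -addn1 natrD natrM.
move: kd; rewrite ltr_pdivrMr ?exprn_gt0// => kd.
have h3 : k%:R * 3 < k%:R * (k%:R * dl ^+ 2) by rewrite ltr_pM2l// (lt_le_trans ltr01).
have h4 : 0 <= k%:R * dl by rewrite mulr_ge0// ltW.
rewrite expr2 in h3.
by rewrite sqrrD expr1n mul1r exprMn -[k%:R ^+ 2]/(k%:R * k%:R) expr2; lra.
Qed.

Section PadicField.
Context (R : realType) (p : nat) (p_prime : prime p).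
Context (Qp : fieldType) (absQ : Qp -> R) (QpP : is_padic_field p absQ).

Let p_gt1 : (1 < p)%N := prime_gt1 p_prime.
Let p_gt0 : (0 < p)%N := prime_gt0 p_prime.
Let pR_gt1 : 1 < p%:R :> R. Proof. by rewrite ltr1n. Qed.
Let pR_gt0 : 0 < p%:R :> R. Proof. by rewrite ltr0n. Qed.
Let pR_neq0 : p%:R != 0 :> R. Proof. by rewrite gt_eqF. Qed.

Lemma padic_absP : absolute_value absQ. Proof. by case: QpP. Qed.
Let vP := padic_absP.

Lemma padic_abs_nat n : (0 < n)%N -> absQ n%:R = p%:R ^ (- (logn p n)%:Z).
Proof.
move=> n0; case: QpP => _ /(_ n%:R) + _ _; rewrite ratr_nat => ->.
rewrite /padic_abs pnatr_eq0 gtn_eqF//.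
by rewrite -[n%:R]/(n%:Z%:~R) numq_int denq_int logn1 sub0r.
Qed.

Lemma padic_abs_nat_le1 n : absQ n%:R <= 1.
Proof.
case: n => [|n]; first by rewrite (abs0 vP) ler01.
by rewrite padic_abs_nat// -[1](expr0z p%:R) ler_eXz2l//; lia.
Qed.

Lemma padic_ultra x y : absQ (x + y) <= Num.max (absQ x) (absQ y).
Proof. exact: (absolute_value_ultrametric vP padic_abs_nat_le1). Qed.
Let ultra := padic_ultra.

Lemma padic_abs_p : absQ p%:R = p%:R^-1.
Proof. by rewrite padic_abs_nat// logn_prime// eqxx. Qed.

Let pQ_neq0 : p%:R != 0 :> Qp.
Proof. by rewrite -(abs_gt0 vP) padic_abs_p invr_gt0. Qed.

Lemma padic_abs_pz (k : int) : absQ (p%:R ^ k) = p%:R ^ (- k).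
Proof. by rewrite (absXz vP) padic_abs_p exprz_inv. Qed.

(** A rational closer to x than |x| has the same absolute value as x. *)
Lemma padic_abs_value x : x != 0 -> exists k : int, absQ x = p%:R ^ k.
Proof.
move=> x0; case: QpP => _ vr _ /(_ x (absQ x)); rewrite (abs_gt0 vP) x0.
move=> /(_ isT)[r xr].
have rx : absQ (ratr r) = absQ x by apply: (abs_eq vP ultra); rewrite (abs_subC vP).
move: rx; rewrite vr /padic_abs; case: ifP => _ rx; last by rewrite -rx; eexists.
by move/eqP: rx; rewrite eq_sym (abs_eq0 vP) (negPf x0).
Qed.

Lemma padic_lt_pz x (k : int) : (absQ x < p%:R ^ (- k)) = (absQ x <= p%:R ^ (- (k + 1))).
Proof.
have [->|/padic_abs_value[j ->]] := eqVneq x 0.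
  by rewrite (abs0 vP) exprz_gt0// ltW// exprz_gt0.
by rewrite ler_eXz2l// ltr_eXz2l//; lia.
Qed.

Lemma padic_abs_nat_lt1 n : (absQ n%:R < 1) = (p %| n)%N.
Proof.
case: n => [|n]; first by rewrite (abs0 vP) ltr01 dvdn0.
rewrite padic_abs_nat// -[1](expr0z p%:R) ltr_eXz2l//.
by rewrite -[p in RHS]expn1 pfactor_dvdn//; lia.
Qed.

(** Values are powers of p, so the strict bound p^(1-k) amounts to the bound p^-k. *)
Lemma padic_nat_close m n k : absQ (m%:R - n%:R) < p%:R ^ (1 - k%:Z) ->
  m = n %[mod p ^ k].
Proof.
wlog nm : m n / (n <= m)%N => [h|].
  have [/h//|/ltnW mn] := leqP n m.
  by rewrite (abs_subC vP) => /(h _ _ mn).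
rewrite -natrB// => h; apply/eqP; rewrite eqn_mod_dvd//.
have [->|d0] := posnP (m - n)%N; first by rewrite dvdn0.
rewrite pfactor_dvdn//; move: h; rewrite padic_abs_nat// ltr_eXz2l//; lia.
Qed.

Lemma padic_abs_int_le1 (z : int) : absQ z%:~R <= 1.
Proof.
by case: (intP z) => [|n|n]; rewrite ?mulrNz ?(absN vP) padic_abs_nat_le1.
Qed.

Lemma padic_pmul_lt1 x : absQ x <= 1 -> absQ (x * p%:R) < 1.
Proof.
move=> x1; rewrite (absM vP) padic_abs_p (le_lt_trans _ (_ : p%:R^-1 < 1))//.
  by rewrite ler_piMl// invr_ge0 ltW.
by rewrite invf_lt1.
Qed.

Lemma padic_int_digit (z : int) : exists d : 'I_p, absQ (z%:~R - d%:R) < 1.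
Proof.
have pz : p%:Z != 0 by rewrite eqz_nat -lt0n.
have := divz_eq z p; have := modz_ge0 z pz; have := @ltz_pmod z p.
case: (z %% p)%Z => // d /(_ p_gt0) dp _ zE.
exists (Ordinal (dp : (d < p)%N)).
rewrite [X in X%:~R]zE intrD addrK intrM.
by rewrite padic_pmul_lt1// padic_abs_int_le1.
Qed.

Lemma padic_nat_unit n : ~~ (p %| n)%N -> absQ n%:R = 1.
Proof.
move=> pn; apply/le_anti; rewrite padic_abs_nat_le1 /= leNgt.
by rewrite padic_abs_nat_lt1.
Qed.

(** A rational z/D near x has D prime to p; Bezout gives u with D u congruent to 1 modulo p, so z/D
    is congruent to the integer z u, which has a digit. *)
Lemma padic_digit x : absQ x <= 1 -> exists d : 'I_p, absQ (x - d%:R) < 1.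
Proof.
move=> x1; case: (QpP) => _ vr _ /(_ x 1 ltr01)[r xr].
suff [d rd] : exists d : 'I_p, absQ (ratr r - d%:R) < 1.
  by exists d; exact: (abs_trans ultra xr rd).
have r1 : absQ (ratr r) <= 1.
  rewrite -(subKr x (ratr r)); apply: (absB_le vP ultra) => //; exact: ltW.
have [->|r0] := eqVneq r 0.
  have [d d1] := padic_int_digit 0; exists d.
  by rewrite (_ : ratr 0 = 0)//; apply/eqP; rewrite -(abs_eq0 vP) vr /padic_abs eqxx.
set D := `|denq r|%N; set z := numq r.
have pD : ~~ (p %| D)%N.
  apply/negP => pD; move: r1; rewrite vr /padic_abs (negPf r0) -/D -/z.
  have pz : ~~ (p %| `|z|)%N.
    apply/negP => pz; have := coprime_num_den r; rewrite -/D -/z.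
    by move=> /eqP cop; have := dvdn_gcd p `|z| D; rewrite pz pD cop dvdn1 gtn_eqF.
  have D0 : (0 < D)%N by rewrite absz_gt0 denq_eq0.
  have -> : logn p `|z|%N = 0%N by rewrite logn_coprime// prime_coprime.
  rewrite subr0.
  rewrite leNgt -[X in X < _](expr0z p%:R) ltr_eXz2l// ltz_nat.
  by rewrite -pfactor_dvdn// expn1 pD.
have D1 := padic_nat_unit pD.
have D_gt0 : (0 < D)%N by rewrite absz_gt0 denq_eq0.
have /(coprimeP _ D_gt0)[[u w] /= uw] : coprime D p.
  by rewrite coprime_sym prime_coprime.
have Du : (D * u = w * p + 1)%N by lia.
have [d dP] := padic_int_digit (z * u%:Z); exists d.
have -> : ratr r = z%:~R / D%:R :> Qp.
  rewrite /ratr -/z /D; congr (_ / _).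
  by rewrite -[RHS]/((`|denq r|%N%:Z)%:~R) absz_denq.
have D0 : D%:R != 0 :> Qp by rewrite -(abs_eq0 vP) D1 oner_eq0.
have -> : z%:~R / D%:R - d%:R =
    ((1 - (D * u)%:R) * z%:~R + D%:R * ((z * u%:Z)%:~R - d%:R)) / D%:R :> Qp.
  by rewrite intrM natrM -[u%:Z%:~R]/(u%:R); field.
rewrite (absM vP) (absV vP) D1 invr1 mulr1; apply: (absD_lt ultra).
  rewrite (absM vP) (le_lt_trans (ler_piMr (abs_ge0 vP _) (padic_abs_int_le1 z)))//.
  rewrite Du natrD opprD addrCA subrr addr0.
  by rewrite (absN vP) natrM padic_pmul_lt1// padic_abs_nat_le1.
by rewrite (absM vP) D1 mul1r.
Qed.

Local Notation digit_sum M a N :=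
  (\sum_(k < N) (a k)%:R * p%:R ^ (k%:Z - M%:Z) : Qp).

Lemma digit_expansion_exists b : exists M a, digit_expansion p absQ b M a.
Proof.
have [M bM] : exists M : nat, absQ b <= p%:R ^ M%:Z.
  have [->|/padic_abs_value[k ->]] := eqVneq b 0.
    by exists 0%N; rewrite (abs0 vP) expr0z ler01.
  by exists `|k|%N; rewrite ler_eXz2l//; lia.
have /choice[dig digP] : forall z, exists d : 'I_p, absQ z <= 1 -> absQ (z - d%:R) < 1.
  move=> z; have [/padic_digit[d zd]|_] := boolP (absQ z <= 1); first by exists d.
  by exists (Ordinal p_gt0).
(* The remainder of b after k digits, multiplied by p^(M-k) to bring it into the closed unit
   ball. *)
pose zs k := iter k (fun z => (z - (dig z)%:R) / p%:R) (b * p%:R ^ M%:Z).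
have zsS k : zs k.+1 = (zs k - (dig (zs k))%:R) / p%:R by [].
have zs1 k : absQ (zs k) <= 1.
  elim: k => [|k IH].
    rewrite (absM vP) padic_abs_pz -ler_pdivlMr ?exprz_gt0// mul1r.
    by rewrite invr_expz opprK.
  rewrite zsS (absM vP) (absV vP) padic_abs_p invrK.
  rewrite -ler_pdivlMr// mul1r; have := digP _ IH.
  by rewrite -[X in _ < X](expr0z p%:R) -oppr0 padic_lt_pz add0r.
exists M, (fun k => nat_of_ord (dig (zs k))); split=> [k|]; first exact: ltn_ord.
have rest N : b - digit_sum M (fun k => nat_of_ord (dig (zs k))) N =
    zs N * p%:R ^ (N%:Z - M%:Z).
  elim: N => [|N IH].
    by rewrite big_ord0 subr0 /zs /= sub0r -mulrA -expfzDr// subrr expr0z mulr1.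
  rewrite zsS big_ord_recr opprD addrA IH [nat_of_ord _]/=.
  have -> : N.+1%:Z - M%:Z = 1 + (N%:Z - M%:Z) by lia.
  rewrite [in RHS]expfzDr// expr1z -mulrBl; set y := p%:R ^ (N%:Z - M%:Z).
  by field.
apply/cvgr0Pnorm_lt => eps eps0; have [k keps] := expz_small pR_gt1 eps0.
exists (k + M)%N => // N /= kN; rewrite ger0_norm ?(abs_ge0 vP)// rest.
rewrite (absM vP) padic_abs_pz (le_lt_trans _ keps)//.
rewrite (le_trans (ler_piMl _ (zs1 N))) ?exprz_ge0//.
by rewrite ler_eXz2l//; lia.
Qed.

Lemma digit_sum_near b M a : digit_expansion p absQ b M a ->
  absQ (b - digit_sum M a M.+1) < 1.
Proof.
move=> [a_lt /cvgr0Pnorm_lt/(_ _ ltr01)[N _ HN]].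
have tail n : absQ (digit_sum M a (M.+1 + n) - digit_sum M a M.+1) < 1.
  elim: n => [|n IH]; first by rewrite addn0 subrr (abs0 vP).
  rewrite addnS big_ord_recr/= addrAC; apply: (absD_lt ultra) => //.
  rewrite (absM vP) padic_abs_pz.
  rewrite (le_lt_trans (ler_piMl _ (padic_abs_nat_le1 _))) ?exprz_ge0//.
  by rewrite -[X in _ < X](expr0z p%:R) ltr_eXz2l//; lia.
apply: (abs_trans ultra _ (tail N)).
by have := HN (M.+1 + N)%N (leq_addl _ _); rewrite /= ger0_norm ?(abs_ge0 vP).
Qed.

(* Over a common denominator both digit sums are natural numbers below
   p^(M+M'+1) that are congruent modulo p^(M+M'+1). *)
Lemma digit_sum_uniq M (a : nat -> nat) M' (a' : nat -> nat) :
  (forall k, (a k < p)%N) -> (forall k, (a' k < p)%N) ->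
  absQ (digit_sum M a M.+1 - digit_sum M' a' M'.+1) < 1 ->
  digit_sum M a M.+1 = digit_sum M' a' M'.+1.
Proof.
pose n M (a : nat -> nat) := (\sum_(k < M.+1) a k * p ^ k)%N.
have n_lt m c : (forall k, (c k < p)%N) -> (n m c < p ^ m.+1)%N.
  rewrite /n => c_lt; elim: (m.+1) => [|i IH]; first by rewrite big_ord0.
  rewrite big_ord_recr/= (@leq_trans (p ^ i + c i * p ^ i))//.
    by rewrite ltn_add2r.
  by rewrite -mulSn expnS leq_mul2r c_lt orbT.
have nE m (c : nat -> nat) : digit_sum m c m.+1 = (n m c)%:R * p%:R ^ (- m%:Z).
  rewrite /n natr_sum mulr_suml; apply: eq_bigr => k _.
  by rewrite expfzDr// natrM natrX mulrA.
move=> a_lt a'_lt.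
pose c := (p ^ (M + M'))%N.
have c0 : c%:R != 0 :> Qp by rewrite natrX expf_neq0.
have cE m c' m' : (n m c')%:R * p%:R ^ (- m%:Z) * (p ^ (m + m'))%:R =
    (n m c' * p ^ m')%:R :> Qp.
  rewrite expnD !natrM !natrX -mulrA; congr (_ * _).
  by rewrite mulrA -exprnN mulVf ?mul1r// expf_neq0.
have E1 := cE M a M'; have := cE M' a' M; rewrite (addnC M' M) => E2.
rewrite !nE => h; apply: (mulIf c0); rewrite E1 E2; congr (_%:R).
have : (n M a * p ^ M' = n M' a' * p ^ M %[mod p ^ (M + M').+1])%N.
  apply: padic_nat_close; rewrite -E1 -E2 -mulrBl.
  rewrite (absM vP) natrX (absX vP) padic_abs_p exprVn exprnN.
  rewrite (_ : 1 - (M + M').+1%:Z = - (M + M')%:Z); last lia.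
  by rewrite gtr_pMl// exprz_gt0.
have lt1 : (n M a * p ^ M' < p ^ (M + M').+1)%N.
  by rewrite -addSn expnD ltn_pmul2r ?expn_gt0 ?p_gt0// n_lt.
have lt2 : (n M' a' * p ^ M < p ^ (M + M').+1)%N.
  by rewrite -addnS addnC expnD ltn_pmul2r ?expn_gt0 ?p_gt0// n_lt.
by rewrite !modn_small.
Qed.

Let padic_floorP b : exists M a, digit_expansion p absQ b M a /\
  padic_floor p absQ b = digit_sum M a M.+1.
Proof.
rewrite /padic_floor; case: xgetP => [y _ //|h].
have [M [a bMa]] := digit_expansion_exists b.
by have := h _ (ex_intro _ M (ex_intro _ a (conj bMa erefl))).
Qed.

Lemma padic_floor_near b : absQ (b - padic_floor p absQ b) < 1.
Proof. by have [M [a [bMa ->]]] := padic_floorP b; exact: digit_sum_near. Qed.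

Lemma padic_floor_eq b c : absQ (b - c) < 1 ->
  padic_floor p absQ b = padic_floor p absQ c.
Proof.
have := padic_floor_near b; have := padic_floor_near c.
have [M [a [[a_lt _] ->]]] := padic_floorP b.
have [M' [a' [[a'_lt _] ->]]] := padic_floorP c.
move=> c1 b1 bc; apply: digit_sum_uniq => //.
by rewrite (abs_subC vP) in b1; exact: (abs_trans ultra b1 (abs_trans ultra bc c1)).
Qed.

End PadicField.

(** * Residues and orthogonal bases of the extension *)

Section PadicExtension.
Context (R : realType) (p : nat) (p_prime : prime p).
Context (Qp : fieldType) (absQ : Qp -> R) (QpP : is_padic_field p absQ).
Context (K : fieldExtType Qp) (abs : K -> R) (absP : absolute_value abs).
Hypothesis abs_ext : forall b : Qp, abs b%:A = absQ b.
Context (e f : nat) (eP : ramification_index abs {:K} e).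
Hypothesis fP : residue_degree absQ abs {:K} f.
Context (gamma : K) (gammaP : (p ^ f - 1).-primitive_root gamma).
Context (beta : K) (abs_beta : abs beta = p%:R `^ (1 / e%:R)).

Let vP := padic_absP QpP.
Let vultra := padic_ultra p_prime QpP.
Let p_gt1 : (1 < p)%N := prime_gt1 p_prime.
Let p_gt0 : (0 < p)%N := prime_gt0 p_prime.
Let pR_gt1 : 1 < p%:R :> R. Proof. by rewrite ltr1n. Qed.
Let pR_gt0 : 0 < p%:R :> R. Proof. by rewrite ltr0n. Qed.
Local Notation b := (abs beta).

Lemma ext_absZ c x : abs (c *: x) = absQ c * abs x.
Proof. by rewrite -mulr_algl (absM absP) abs_ext. Qed.

Lemma ext_abs_int (z : int) : abs z%:~R = absQ z%:~R.
Proof. by rewrite -abs_ext -[in RHS]mulrzl mulr1; congr abs; rewrite scaler_int. Qed.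

Lemma ext_abs_nat n : abs n%:R = absQ n%:R.
Proof. by rewrite -abs_ext scaler_nat. Qed.

Lemma ext_ultra x y : abs (x + y) <= Num.max (abs x) (abs y).
Proof.
apply: (absolute_value_ultrametric absP) => n.
by rewrite ext_abs_nat (padic_abs_nat_le1 p_prime QpP).
Qed.
Let ultra := ext_ultra.

Let e_gt0 : (0 < e)%N.
Proof.
rewrite lt0n; apply/eqP => e0; move: eP; rewrite /ramification_index e0 II0.
rewrite card_eq0 => /eqP/seteqP[+ _].
move=> /(_ _ (ex_intro2 _ _ (abs 1) (ex_intro2 _ _ 1 _ erefl) erefl)); apply.
by rewrite /= memvf oner_neq0.
Qed.

Let b_expe : b ^+ e = p%:R.
Proof.
rewrite abs_beta -powR_mulrn ?powR_ge0// -powRrM div1r mulVf ?powRr1//.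
by rewrite pnatr_eq0 -lt0n.
Qed.

Lemma ext_b_gt1 : 1 < b.
Proof.
rewrite ltNge; apply/negP => b1.
have := pR_gt1; rewrite -b_expe ltNge => /negP; apply.
by rewrite exprn_ile1// (abs_ge0 absP).
Qed.
Let b_gt1 := ext_b_gt1.
Let b_gt0 : 0 < b. Proof. exact: lt_trans b_gt1. Qed.

Let p_b (k : int) : p%:R ^ k = b ^ (e%:Z * k).
Proof. by rewrite -b_expe -exprz_exp. Qed.

(* By counting cosets, two of the e + 1 elements beta ^ i (i < e) and x have the
   same absolute value up to a power of p = b^e. *)
Lemma ext_abs_value x : x != 0 -> exists k : int, abs x = b ^ k.
Proof.
move=> x0.
pose coset r := [set r * s | s in value_group abs 1%VS].
pose r (i : 'I_e.+1) : K := if (i < e)%N then beta ^+ i else x.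
have r_neq0 i : r i != 0.
  by rewrite /r; case: ifP => _ //; rewrite expf_neq0// -(abs_gt0 absP).
have [i [j [ij rij]]] : exists i j, i != j /\ coset (abs (r i)) = coset (abs (r j)).
  have : ([set coset s | s in value_group abs {:K}%VS] #<= `I_e)%card.
    by have := eP; rewrite /ramification_index card_eq_le => /andP[].
  move=> /pcard_leP[g].
  have g_lt i : (g (coset (abs (r i))) < e)%N.
    apply: (@funS _ _ _ _ g); exists (abs (r i)) => //; exists (r i) => //=.
    by rewrite memvf.
  have /injectivePn[i [j ij /(congr1 val)/= gij]] :
      ~~ injectiveb (fun i => Ordinal (g_lt i)).
    by apply/negP => /injectiveP/leq_card; rewrite !card_ord ltnn.
  exists i, j; split=> //; apply: (@inj _ _ _ g) gij; rewrite inE.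
    by exists (abs (r i)) => //; exists (r i) => //=; rewrite memvf.
  by exists (abs (r j)) => //; exists (r j) => //=; rewrite memvf.
have {rij} [k rijk] : exists k : int, abs (r i) = abs (r j) * b ^ (e%:Z * k).
  have : coset (abs (r i)) (abs (r i)).
    exists 1; rewrite ?mulr1//; exists 1; rewrite ?(abs1 absP)//=.
    by rewrite mem1v oner_neq0.
  rewrite rij => -[_ [_ [/vlineP[c ->] c0] <-] <-].
  have [|k ck] := padic_abs_value p_prime QpP (x := c).
    by apply: contra_neq c0 => ->; rewrite scale0r.
  by exists k; rewrite abs_ext ck p_b.
have b_inj := ieexprIz b_gt0 (negbT (gt_eqF b_gt1)).
have bX (n : nat) : abs (beta ^+ n) = b ^ n%:Z by rewrite (absX absP).
(* Distinct exponents below e are incongruent modulo e, so exactly one of the two elements is x, and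
   the relation is solved for |x|. *)
move: rijk; rewrite /r; case: ifP => ie; case: ifP => je.
- rewrite !bX -expfzDr ?gt_eqF// => /b_inj h; case/negP: ij; apply/eqP/val_inj => /=.
  have k0 : k = 0 by move: (ltn_ord i) (ltn_ord j); clear -h ie je; nia.
  by move: h; rewrite k0; clear; lia.
- rewrite bX => h; exists (i%:Z - e%:Z * k); rewrite expfzDr ?gt_eqF// h.
  by rewrite -mulrA -expfzDr ?gt_eqF// subrr expr0z mulr1.
- by rewrite bX -expfzDr ?gt_eqF// => ->; eexists.
- case/negP: ij; apply/eqP/val_inj => /=; move: (ltn_ord i) (ltn_ord j).
  by clear -ie je; lia.
Qed.

(** * The residue field and the powers of gamma *)

Let f_gt0 : (0 < f)%N.
Proof.
have := prim_order_gt0 gammaP; rewrite subn_gt0.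
by case: f => [|//]; rewrite expn0.
Qed.

(* The residue field has at most p ^ f elements. *)
Lemma residues_complete (I : finType) (t : I -> K) :
  #|I| = (p ^ f)%N -> (forall i, abs (t i) <= 1) ->
  (forall i j, abs (t i - t j) < 1 -> i = j) ->
  forall x, abs x <= 1 -> exists i, abs (x - t i) < 1.
Proof.
move=> cardI t1 t_inj x x1; have [u [uE u_span _]] := fP.
have /choice[cls clsP] : forall x, exists d : {ffun 'I_f -> 'I_p}, abs x <= 1 ->
    abs (x - \sum_i (d i)%:R * u i) < 1.
  move=> y; have [y1|_] := boolP (abs y <= 1); last first.
    by exists [ffun=> Ordinal p_gt0].
  have [c [c1 yc]] := u_span y (memvf _) y1.
  have /choice[d dP] : forall i, exists d : 'I_p, absQ (c i - d%:R) < 1.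
    by move=> i; exact: (padic_digit p_prime QpP).
  exists [ffun i => d i] => _; apply: (abs_trans ultra yc).
  rewrite -sumrB; apply: (abs_sum_lt absP ultra) => // i _.
  rewrite ffunE mulr_natl -scaler_nat -scalerBl.
  rewrite ext_absZ (le_lt_trans _ (dP i))// ler_piMr ?(abs_ge0 vP)//.
  by have [] := uE i.
have same y z : abs y <= 1 -> abs z <= 1 -> cls y = cls z -> abs (y - z) < 1.
  move=> /clsP hy /clsP hz yz; rewrite yz in hy.
  by rewrite (abs_subC absP) in hz; exact: (abs_trans ultra hy hz).
have ct_inj : injective (cls \o t).
  by move=> i j /= /(same _ _ (t1 i) (t1 j))/t_inj.
(* An injection between sets of p^f elements is onto. *)
have /codomP[i /= xi] : cls x \in codom (cls \o t).
  by apply: inj_card_onto => //; rewrite card_ffun !card_ord cardI.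
by exists i; exact: same.
Qed.

Let abs_gamma : abs gamma = 1.
Proof.
apply/eqP; rewrite -(@pexpr_eq1 _ _ (p ^ f - 1)) ?(abs_ge0 absP)//.
  by rewrite -(absX absP) (prim_expr_order gammaP) (abs1 absP).
exact: prim_order_gt0 gammaP.
Qed.

Let abs_gammaX i : abs (gamma ^+ i) = 1.
Proof. by rewrite (absX absP) abs_gamma expr1n. Qed.

(* If zeta = gamma ^ k <> 1 were congruent to 1, then the order N of gamma,
   which is prime to p, would be congruent to the sum of the zeta ^ i, i < N,
   which vanishes. *)
Lemma gamma_separated i j : (i < p ^ f - 1)%N -> (j < p ^ f - 1)%N ->
  abs (gamma ^+ i - gamma ^+ j) < 1 -> i = j.
Proof.
wlog ji : i j / (j <= i)%N => [h iN jN|iN jN].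
  have [/h|/ltnW/h] := leqP j i; first exact.
  by move=> /(_ jN iN); rewrite (abs_subC absP) => /[apply].
rewrite -{1}(subnKC ji) exprD -{2}[gamma ^+ j]mulr1 -mulrBr (absM absP).
rewrite abs_gammaX mul1r => near1; set N := (p ^ f - 1)%N in iN jN.
set zeta := gamma ^+ (i - j) in near1.
have [/eqP|zeta1] := eqVneq zeta 1.
  rewrite -(prim_order_dvd gammaP) -/N => Nij.
  have [|ij0] := posnP (i - j)%N; last first.
    by move: (dvdn_leq ij0 Nij); clear -iN; lia.
  by move=> ij0; apply/eqP; rewrite eqn_leq ji andbT -subn_eq0 ij0.
have zN : zeta ^+ N = 1.
  by rewrite /zeta exprAC (prim_expr_order gammaP) expr1n.
have sum0 : \sum_(k < N) zeta ^+ k = 0.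
  have := subrX1 zeta N; rewrite zN subrr => /esym/eqP.
  by rewrite mulf_eq0 subr_eq0 (negPf zeta1) => /eqP.
have : abs (\sum_(k < N) (1 - zeta ^+ k)) < 1.
  apply: (abs_sum_lt absP ultra) => // k _.
  rewrite (abs_subC absP) subrX1 (absM absP) (le_lt_trans _ near1)//.
  rewrite ler_piMr ?(abs_ge0 absP)//; apply: (abs_sum_le absP ultra) => // m _.
  by rewrite !(absX absP) abs_gamma !expr1n.
rewrite sumrB sum0 subr0 sumr_const card_ord ext_abs_nat.
rewrite (padic_abs_nat_lt1 p_prime QpP) => pN.
have : (p %| p ^ f - N)%N by rewrite dvdn_sub// dvdn_exp.
rewrite /N subKn ?expn_gt0 ?p_gt0// dvdn1 => /eqP p1.
by move: p_gt1; rewrite p1.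
Qed.

Let teich (i : option 'I_(p ^ f - 1)) : K :=
  if i is Some i then gamma ^+ i else 0.

Let card_teich : #|{: option 'I_(p ^ f - 1)}| = (p ^ f)%N.
Proof. by rewrite card_option card_ord subn1 prednK// expn_gt0 p_gt0. Qed.

Let teich_inj i j : abs (teich i - teich j) < 1 -> i = j.
Proof.
case: i j => [i|] [j|] //=; rewrite ?subr0 ?sub0r ?(absN absP) ?abs_gammaX ?ltxx//.
by move=> /(gamma_separated (ltn_ord i) (ltn_ord j)) ij; congr Some; exact: val_inj.
Qed.

(** The span of the powers of gamma below d over the prime field, modulo the open unit ball;
    integers represent the prime field. *)
Let gamma_span d x :=
  exists z : nat -> int, abs (x - \sum_(j < d) (z j)%:~R * gamma ^+ j) < 1.

(* If gamma ^ d were congruent to an integral combination of lower powers, all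
   the p ^ f Teichmueller representatives would be represented by the p ^ d
   combinations with digits as coefficients. *)
Let gamma_span_big d : gamma_span d (gamma ^+ d) -> (f <= d)%N.
Proof.
move=> span_d.
have span0 : gamma_span d 0.
  exists (fun=> 0); rewrite big1 ?subrr ?(abs0 absP)// => i _.
  by rewrite mul0r.
have spanD x y : gamma_span d x -> gamma_span d y -> gamma_span d (x + y).
  move=> [z xz] [w yw]; exists (fun j => z j + w j).
  under eq_bigr do rewrite intrD mulrDl.
  by rewrite big_split/= opprD addrACA; exact: (absD_lt ultra).
have abs_int1 (z : int) : abs z%:~R <= 1.
  by rewrite ext_abs_int (padic_abs_int_le1 p_prime QpP).
have spanZ (c : int) x : gamma_span d x -> gamma_span d (c%:~R * x).
  move=> [z xz]; exists (fun j => c * z j).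
  under eq_bigr do rewrite intrM -mulrA.
  rewrite -mulr_sumr -mulrBr (absM absP) (le_lt_trans _ xz)//.
  by rewrite ler_piMl ?(abs_ge0 absP).
have span_low j : (j <= d)%N -> gamma_span d (gamma ^+ j).
  rewrite leq_eqVlt => /orP[/eqP->//|jd].
  exists (fun i => (i == j)%:Z); rewrite (bigD1 (Ordinal jd))//= eqxx mul1r.
  rewrite big1 ?addr0 ?subrr ?(abs0 absP)// => i.
  by rewrite -val_eqE /= => /negPf->; rewrite mul0r.
have span_sum n (z : nat -> int) (g : nat -> K) :
    (forall j, (j < n)%N -> gamma_span d (g j)) ->
    gamma_span d (\sum_(j < n) (z j)%:~R * g j).
  elim: n => [|n IH] gs; first by rewrite big_ord0.
  rewrite big_ord_recr /=; apply: spanD; last exact/spanZ/gs.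
  by apply: IH => j jn; apply: gs; exact: ltnW.
have span_near x y : abs (x - y) < 1 -> gamma_span d y -> gamma_span d x.
  by move=> xy [z yz]; exists z; exact: (abs_trans ultra xy yz).
(* Multiplication by gamma raises each power by one, and gamma^d is in the span by hypothesis. *)
have spanX k : gamma_span d (gamma ^+ k).
  elim: k => [|k [z kz]]; first exact: span_low.
  apply: (span_near _ (gamma * \sum_(j < d) (z j)%:~R * gamma ^+ j)).
    by rewrite exprS -mulrBr (absM absP) abs_gamma mul1r.
  rewrite mulr_sumr; under eq_bigr do rewrite mulrCA -exprS.
  by apply: (span_sum _ _ (fun j => gamma ^+ j.+1)) => j; exact: span_low.
have span_teich i : gamma_span d (teich i) by case: i => [i|] /=.
have /choice[c cP] : forall i, exists c : {ffun 'I_d -> 'I_p},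
    abs (teich i - \sum_j (c j)%:R * gamma ^+ j) < 1.
  move=> i; have [z iz] := span_teich i.
  have /choice[c cP] : forall j : 'I_d, exists c : 'I_p, absQ ((z j)%:~R - c%:R) < 1.
    by move=> j; exact: (padic_int_digit p_prime QpP).
  exists [ffun j => c j]; apply: (abs_trans ultra iz).
  rewrite -sumrB; apply: (abs_sum_lt absP ultra) => // j _.
  rewrite ffunE -mulrBl (absM absP) abs_gammaX mulr1.
  by rewrite -[(c j)%:R]/((c j)%:Z%:~R) -intrB ext_abs_int intrB.
have : injective c.
  move=> i j cij; apply: teich_inj; have := cP i; rewrite cij => hi.
  by have := cP j; rewrite (abs_subC absP) => hj; exact: (abs_trans ultra hi hj).
move=> /leq_card; rewrite card_teich card_ffun !card_ord.
by rewrite leq_exp2l.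
Qed.

Lemma gamma_independent d (z : nat -> int) : (d <= f)%N ->
  abs (\sum_(j < d) (z j)%:~R * gamma ^+ j) < 1 ->
  forall j, (j < d)%N -> absQ (z j)%:~R < 1.
Proof.
elim: d => [//|d IH] df; rewrite big_ord_recr/= => sum1.
have zd : absQ (z d)%:~R < 1.
  rewrite ltNge; apply/negP => zd1.
  have z1 : absQ (z d)%:~R = 1.
    by apply/le_anti; rewrite zd1 (padic_abs_int_le1 p_prime QpP).
  have z0 : (z d)%:~R != 0 :> Qp by rewrite -(abs_eq0 vP) z1 oner_eq0.
  have [|w wz] := padic_digit p_prime QpP (x := (z d)%:~R^-1).
    by rewrite (absV vP) z1 invr1.
  suff /gamma_span_big : gamma_span d (gamma ^+ d) by rewrite leqNgt df.
  exists (fun j => - (w%:Z * z j)).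
  have -> : gamma ^+ d - \sum_(j < d) (- (w%:Z * z j))%:~R * gamma ^+ j =
      (1 - w%:R * (z d)%:~R) * gamma ^+ d +
      w%:R * (\sum_(j < d) (z j)%:~R * gamma ^+ j + (z d)%:~R * gamma ^+ d).
    have -> : \sum_(j < d) (- (w%:Z * z j))%:~R * gamma ^+ j =
        - (w%:R * \sum_(j < d) (z j)%:~R * gamma ^+ j).
      rewrite mulr_sumr -sumrN; apply: eq_bigr => j _.
      by rewrite mulrNz intrM mulNr mulrA.
    by ring.
  apply: (absD_lt ultra).
    rewrite (absM absP) abs_gammaX mulr1.
    have -> : 1 - w%:R * (z d)%:~R = (1 - w%:Z * z d)%:~R :> K by rewrite intrB intrM.
    rewrite ext_abs_int intrB intrM -[_ - _]mulr1 -[X in _ * X](mulVf z0).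
    have -> : (1 - w%:R * (z d)%:~R) * ((z d)%:~R^-1 * (z d)%:~R) =
        ((z d)%:~R^-1 - w%:R) * (z d)%:~R :> Qp by field.
    by rewrite (absM vP) z1 mulr1.
  rewrite (absM absP) (le_lt_trans _ sum1)// ler_piMl ?(abs_ge0 absP)//.
  by rewrite ext_abs_nat (padic_abs_nat_le1 p_prime QpP).
move=> j; rewrite ltnS leq_eqVlt => /orP[/eqP->//|jd].
apply: IH => //; first exact: ltnW.
rewrite -[X in abs X](addrK ((z d)%:~R * gamma ^+ d)); apply: (absB_lt absP ultra) => //.
by rewrite (absM absP) abs_gammaX mulr1 ext_abs_int.
Qed.

Let gamma_independent_ord (z : 'I_f -> int) :
  abs (\sum_j (z j)%:~R * gamma ^+ j) < 1 -> forall j, absQ (z j)%:~R < 1.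
Proof.
pose z' j := oapp z 0 (insub j : option 'I_f) => sum1 j.
have zE (i : 'I_f) : z' i = z i by rewrite /z' valK.
rewrite -zE; apply: (gamma_independent (leqnn f)) => //.
by under eq_bigr do rewrite zE.
Qed.

(** A second system of representatives besides [teich], made of combinations of the gamma^j so that
    it can serve to approximate by basis elements. *)
Definition residue (c : {ffun 'I_f -> 'I_p}) : K := \sum_j (c j)%:R * gamma ^+ j.

Lemma residue_le1 c : abs (residue c) <= 1.
Proof.
apply: (abs_sum_le absP ultra) => // j _.
by rewrite (absM absP) abs_gammaX mulr1 ext_abs_nat (padic_abs_nat_le1 p_prime QpP).
Qed.

Lemma residue_inj c d : abs (residue c - residue d) < 1 -> c = d.
Proof.
rewrite -sumrB (eq_bigr (fun j => ((c j)%:Z - (d j)%:Z)%:~R * gamma ^+ j)); last first.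
  by move=> j _; rewrite intrB mulrBl.
move=> /gamma_independent_ord cd; apply/ffunP => j; apply: val_inj => /=.
have := cd j; rewrite intrB => cdj.
have := @padic_nat_close _ _ p_prime _ _ QpP (c j) (d j) 1.
by rewrite subrr expr0z expn1 !modn_small//; exact.
Qed.

Lemma residue_surj x : abs x <= 1 -> exists c, abs (x - residue c) < 1.
Proof.
apply: residues_complete residue_le1 residue_inj x.
by rewrite card_ffun !card_ord.
Qed.

(** * Orthogonality and spanning of the basis *)

Lemma gamma_norm (c : 'I_f -> Qp) j : absQ (c j) <= abs (\sum_j c j *: gamma ^+ j).
Proof.
have [m c_max] := fin_argmax j (fun j => absQ (c j)).
apply: le_trans (c_max j) _.
have [->|cm0] := eqVneq (c m) 0; first by rewrite (abs0 vP) (abs_ge0 absP).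
rewrite leNgt; apply/negP => lt.
(* Division by the largest coefficient gives integral coefficients with a 1 at [m]; replaced by
   their digits, they contradict independence modulo the open unit ball. *)
have small : abs (\sum_j (c j / c m) *: gamma ^+ j) < 1.
  have -> : \sum_j (c j / c m) *: gamma ^+ j = (c m)^-1 *: \sum_j c j *: gamma ^+ j.
    by rewrite scaler_sumr; apply: eq_bigr => i _; rewrite scalerA mulrC.
  by rewrite ext_absZ (absV vP) mulrC ltr_pdivrMr ?mul1r// (abs_gt0 vP).
have /choice[z zP] : forall j, exists z : 'I_p, absQ (c j / c m - z%:R) < 1.
  move=> i; apply: (padic_digit p_prime QpP).
  by rewrite (absM vP) (absV vP) ler_pdivrMr ?mul1r// (abs_gt0 vP).
have : abs (\sum_j ((z j)%:Z)%:~R * gamma ^+ j) < 1.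
  rewrite -[X in abs X](subKr (\sum_j (c j / c m) *: gamma ^+ j)).
  apply: (absB_lt absP ultra) => //; rewrite -sumrB.
  apply: (abs_sum_lt absP ultra) => // i _.
  rewrite -[(z i)%:Z%:~R]/((z i)%:R) mulr_natl -scaler_nat -scalerBl ext_absZ.
  by rewrite abs_gammaX mulr1.
move=> /gamma_independent_ord/(_ m) zm.
have := absD_lt vultra (zP m) zm.
by rewrite divff// subrK (abs1 vP) ltxx.
Qed.

(** The absolute value is that of the largest coefficient. In terms of b the exponent is thus a
    multiple of e, which separates the terms with different powers of beta. *)
Let gamma_norm_value (c : 'I_f -> Qp) : \sum_j c j *: gamma ^+ j != 0 ->
  exists k : int, abs (\sum_j c j *: gamma ^+ j) = p%:R ^ k.
Proof.
set x := \sum_j _ => x0.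
have [m c_max] := fin_argmax (Ordinal f_gt0) (fun j => absQ (c j)).
have xm : abs x = absQ (c m).
  apply/le_anti; rewrite gamma_norm andbT.
  apply: (abs_sum_le absP ultra) => [|j _]; first exact: abs_ge0 vP _.
  by rewrite ext_absZ abs_gammaX mulr1.
rewrite xm; apply: (padic_abs_value p_prime QpP).
by rewrite -(abs_gt0 vP) -xm (abs_gt0 absP).
Qed.

Let comb (c : 'I_e -> 'I_f -> Qp) : K :=
  \sum_i \sum_j c i j *: (gamma ^+ j * beta ^+ i).

Let combE c : comb c = \sum_i (\sum_j c i j *: gamma ^+ j) * beta ^+ i.
Proof.
apply: eq_bigr => i _; rewrite mulr_suml; apply: eq_bigr => j _.
by rewrite scalerAl.
Qed.

Let combB c d : comb (fun i j => c i j - d i j) = comb c - comb d.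
Proof.
rewrite /comb -sumrB; apply: eq_bigr => i _; rewrite -sumrB.
by apply: eq_bigr => j _; rewrite scalerBl.
Qed.

(* The nonzero terms of the sum over i have pairwise distinct absolute values, as
   their exponents of b are distinct modulo e. *)
Lemma basis_norm (c : 'I_e -> 'I_f -> Qp) i j : absQ (c i j) * b ^+ i <= abs (comb c).
Proof.
pose y (k : 'I_e) := (\sum_j c k j *: gamma ^+ j) * beta ^+ k.
have -> : comb c = \sum_k y k := combE c.
have h : absQ (c i j) * b ^+ i <= abs (y i).
  by rewrite /y (absM absP) (absX absP) ler_wpM2r ?exprn_ge0 ?(abs_ge0 absP)// gamma_norm.
apply: (le_trans h); apply: (abs_sum_distinct absP ultra) => {h i j} i j yi yj.
move: yi yj; rewrite /y !mulf_eq0 !negb_or => /andP[xi _] /andP[xj _].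
rewrite !(absM absP) !(absX absP).
have [k ->] := gamma_norm_value xi; have [m ->] := gamma_norm_value xj.
rewrite !p_b !exprnP -!expfzDr ?gt_eqF//.
move=> /(ieexprIz b_gt0 (negbT (gt_eqF b_gt1))) h; apply: val_inj => /=.
have he : e%:Z * (k - m) = j%:Z - i%:Z by rewrite mulrBr; lia.
have km : k - m = 0 by move: (k - m) he (ltn_ord i) (ltn_ord j) => t; nia.
by move: he; rewrite km mulr0; lia.
Qed.

Lemma basis_norm_le (c : 'I_e -> 'I_f -> Qp) (r : R) : 0 <= r ->
  (forall i j, absQ (c i j) * b ^+ i <= r) -> abs (comb c) <= r.
Proof.
move=> r0 cr; apply: (abs_sum_le absP ultra) => // i _.
apply: (abs_sum_le absP ultra) => // j _.
by rewrite ext_absZ (absM absP) abs_gammaX mul1r (absX absP).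
Qed.

(** Writing s = q e + i with 0 <= i < e, the element t = p^-q beta^i has absolute value b^s, and x/t
    is approximated by a [residue]. *)
Let basis_approx (s : int) x : abs x <= b ^ s -> exists c, abs (x - comb c) < b ^ s.
Proof.
move=> xs; have e0 : e%:Z != 0 by rewrite eqz_nat -lt0n.
have := divz_eq s e; have := modz_ge0 s e0; have := @ltz_pmod s e.
set q := (s %/ e)%Z; case: (s %% e)%Z => // i /(_ e_gt0) ie _ sE.
pose i0 : 'I_e := Ordinal (ie : (i < e)%N).
pose t : K := (p%:R ^ (- q))%:A * beta ^+ i.
have abs_t : abs t = b ^ s.
  rewrite (absM absP) abs_ext (padic_abs_pz p_prime QpP) opprK (absX absP) p_b.
  by rewrite exprnP -expfzDr ?gt_eqF// sE mulrC.
have t0 : t != 0 by rewrite -(abs_gt0 absP) abs_t exprz_gt0.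
have [|d xd] := @residue_surj (x / t).
  by rewrite (absM absP) (absV absP) abs_t ler_pdivrMr ?mul1r// exprz_gt0.
exists (fun i j => if i == i0 then p%:R ^ (- q) * (d j)%:R else 0).
rewrite combE (bigD1 i0)//= eqxx [X in _ - (_ + X)]big1; last first.
  move=> k ki; rewrite [X in X * _]big1 ?mul0r// => j _.
  by rewrite ifN_eq ?scale0r.
rewrite addr0.
have -> : (\sum_j (p%:R ^ (- q) * (d j)%:R) *: gamma ^+ j) * beta ^+ i = t * residue d.
  rewrite mulrC /t -[in RHS]mulrA [RHS]mulrCA; congr (_ * _).
  rewrite mulr_algl scaler_sumr; apply: eq_bigr => j _.
  by rewrite -scalerA scaler_nat mulr_natl.
rewrite -{1}(divfK t0 x) [_ / t * t]mulrC -mulrBr (absM absP) abs_t.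
by rewrite gtr_pMr// exprz_gt0.
Qed.

Let int_step (s : int) x : abs x < b ^ s -> abs x <= b ^ (s - 1).
Proof.
have [->|/ext_abs_value[k ->]] := eqVneq x 0.
  by move=> _; rewrite (abs0 absP) exprz_ge0// ltW.
by rewrite ler_eXz2l// ltr_eXz2l//; lia.
Qed.

Lemma basis_span x : exists c, x = comb c.
Proof.
have [s xs] : exists s : int, abs x <= b ^ s.
  have [->|/ext_abs_value[k ->]] := eqVneq x 0; last by exists k.
  by exists 0; rewrite (abs0 absP) expr0z ler01.
have /choice[C CP] : forall st : int * K, exists c,
    abs st.2 <= b ^ st.1 -> abs (st.2 - comb c) <= b ^ (st.1 - 1).
  move=> [t y] /=; have [/basis_approx[c yc]|_] := boolP (abs y <= b ^ t).
    by exists c => _; exact: int_step.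
  by exists (fun _ _ => 0).
pose st n := iter n (fun st => (st.1 - 1, st.2 - comb (C st))) (s, x).
have stS n : st n.+1 = ((st n).1 - 1, (st n).2 - comb (C (st n))) by [].
have st1 n : (st n).1 = s - n%:Z.
  by elim: n => [|n IH]; rewrite ?subr0// stS /= IH; lia.
have st_le n : abs (st n).2 <= b ^ (s - n%:Z).
  rewrite -st1; elim: n => [|n IH]; first exact: xs.
  by rewrite stS; exact: CP.
pose acc n i j : Qp := \sum_(k < n) C (st k) i j.
have accE n : x - comb (acc n) = (st n).2.
  elim: n => [|n IH].
    rewrite (_ : comb _ = 0) ?subr0// /comb big1// => i _; rewrite big1// => j _.
    by rewrite /acc big_ord0 scale0r.
  rewrite stS /= -IH -addrA -opprD; congr (_ - _).
  rewrite /comb -big_split; apply: eq_bigr => i _; rewrite -big_split.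
  by apply: eq_bigr => j _; rewrite /= /acc big_ord_recr/= scalerDl.
have b_expn_ge1 n : 1 <= b ^+ n by rewrite exprn_ege1// ltW.
(* By [basis_norm] and b^i >= 1, each coefficient inherits the Cauchy property of the partial
   sums. *)
have /choice[l lP] : forall ij : 'I_e * 'I_f, exists l : Qp,
    (fun n => absQ (acc n ij.1 ij.2 - l)) @ \oo --> (0 : R).
  move=> [i j]; case: (QpP) => _ _ + _; apply => eps eps0.
  have [k kP] := expz_small b_gt1 eps0.
  exists (`|s| + k)%N => m n mk nk.
  apply: le_lt_trans kP; rewrite -[leLHS]mulr1.
  apply: (@le_trans _ _ (absQ (acc m i j - acc n i j) * b ^+ i)).
    by rewrite ler_wpM2l ?(abs_ge0 vP).
  apply: (le_trans (basis_norm (fun i j => acc m i j - acc n i j) i j)).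
  have -> : comb (fun i j => acc m i j - acc n i j) = (st n).2 - (st m).2.
    by rewrite combB -!accE; ring.
  apply: (absB_le absP ultra); rewrite (le_trans (st_le _))// ler_eXz2l//.
    by clear -nk; lia.
  by clear -mk; lia.
exists (fun i j => l (i, j)); apply/eqP; rewrite -subr_eq0 -(abs_eq0 absP).
set r := abs _; rewrite eq_le (abs_ge0 absP) andbT leNgt; apply/negP => r0.
(* The factor b^e absorbs the weights b^i, i < e, of the coefficients. *)
have r2 : 0 < r / 2 / b ^+ e by rewrite !divr_gt0// exprn_gt0.
have [N _ HN] : \forall n \near \oo, forall ij : 'I_e * 'I_f,
    absQ (acc n ij.1 ij.2 - l ij) < r / 2 / b ^+ e.
  apply: filter_forall => ij; have /cvgr0Pnorm_lt/(_ _ r2) := lP ij.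
  by apply: filterS => n; rewrite ger0_norm// (abs_ge0 vP).
have [k kP] : exists k : nat, b ^ (- k%:Z) < r / 2.
  by apply: expz_small => //; rewrite divr_gt0.
pose n := (N + `|s| + k)%N.
suff : r <= r / 2 by lra.
have rE : r = abs ((x - comb (acc n)) + comb (fun i j => acc n i j - l (i, j))).
  by rewrite combB addrA subrK.
rewrite [leLHS]rE.
apply: (absD_le ultra).
  rewrite accE (le_trans (st_le n))// (le_trans _ (ltW kP))// ler_eXz2l//.
  by rewrite /n; clear; lia.
apply: basis_norm_le => [|i j]; first by rewrite divr_ge0// ltW.
have /(_ (i, j))/= h := HN n (leq_trans (leq_addr _ _) (leq_addr _ _)).
apply: (@le_trans _ _ (r / 2 / b ^+ e * b ^+ e)).
  rewrite ler_pM ?(abs_ge0 vP) ?exprn_ge0 ?ltW//.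
  by rewrite ltr_eXn2l.
by rewrite divfK// gt_eqF// exprn_gt0.
Qed.

(** * The floor function of the extension *)

Local Notation floor := (ext_floor p absQ e f gamma beta).

Let floorP x : exists c, x = comb c /\
  floor x = comb (fun i j => padic_floor p absQ (c i j)).
Proof.
rewrite /ext_floor; case: xgetP => [y _ [c [xc yc]]|h]; first by exists c.
have [c xc] := basis_span x.
by have := h _ (ex_intro _ c (conj xc erefl)).
Qed.

(** The coefficients of the difference are at most 1/p = b^-e, and their weights b^i have i <= e -
    1, so b^-1 is a bound. *)
Lemma ext_floor_near x : abs (x - floor x) < 1.
Proof.
have [c [xc ->]] := floorP x; rewrite [X in X - _]xc -combB.
apply: (@le_lt_trans _ _ b^-1); last by rewrite invf_lt1.
apply: basis_norm_le => [|i j]; first by rewrite invr_ge0 ltW.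
have := padic_floor_near p_prime QpP (c i j).
rewrite -[X in _ < X](expr0z p%:R) -oppr0 (padic_lt_pz p_prime QpP) add0r => h.
apply: (@le_trans _ _ (p%:R ^ (- 1) * b ^+ i)).
  by rewrite ler_wpM2r// exprn_ge0// ltW.
rewrite p_b exprnP -expfzDr ?gt_eqF// -exprN1 ler_eXz2l//.
by have := ltn_ord i; lia.
Qed.

(** By orthogonality and b^i >= 1, the coefficients of x and y differ by less than 1, so their
    floors agree. *)
Lemma ext_floor_eq x y : abs (x - y) < 1 -> floor x = floor y.
Proof.
have [c [xc ->]] := floorP x; have [d [yd ->]] := floorP y.
rewrite xc yd -combB => cd; apply: eq_bigr => i _; apply: eq_bigr => j _.
congr (_ *: _); apply: (padic_floor_eq p_prime QpP).
apply: le_lt_trans cd; rewrite -[leLHS]mulr1.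
apply: le_trans (basis_norm (fun i j => c i j - d i j) i j).
by rewrite ler_wpM2l ?(abs_ge0 vP)// exprn_ege1// ltW.
Qed.

End PadicExtension.

Theorem theorem24 (R : realType) (p : nat) (p_prime : prime p)
    (Qp : fieldType) (absQ : Qp -> R) (QpP : is_padic_field p absQ)
    (K : fieldExtType Qp) (abs : K -> R) (absP : absolute_value abs)
    (abs_ext : forall b : Qp, abs b%:A = absQ b)
    (e f : nat) (eP : ramification_index abs {:K} e)
    (fP : residue_degree absQ abs {:K} f)
    (L : {subfield K}) (L_dim : \dim L = f) (L_unram : ramification_index abs L 1)
    (gamma : K) (gammaP : (p ^ f - 1).-primitive_root gamma)
    (L_gen : <<1; gamma>>%VS = L)
    (beta : K) (K_gen : <<L; beta>>%VS = {:K}%VS)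
    (abs_beta : abs beta = p%:R `^ (1 / e%:R))
    (mu : {measure set (borel_space abs) -> \bar R})
    (muP : is_haar_measure mu) (mu_norm : mu (abs_ball abs 0 1) = 1%E)
    (a : nat -> nat) (a_good : L2_good_universal R a)
    (a_ud : forall theta : R, irrational theta ->
       unif_distr_mod1 (fun n => (a n)%:R * theta))
    (l : nat) (l_gt0 : (0 < l)%N) :
  let c n alpha := partial_quotient p absQ e f gamma beta n alpha in
  {ae mu, forall alpha : K, abs_ball abs 0 1 alpha ->
     frequency R (fun j => abs (c (a j) alpha) == p%:R `^ (l%:R / e%:R)) @ \oo
       --> ((p%:R ^+ f - 1) / p%:R ^+ (f * l) : R)
     /\
     frequency R (fun j => abs (c (a j) alpha) >= p%:R `^ (l%:R / e%:R)) @ \oo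
       --> (1 / p%:R ^+ (f * (l - 1)) : R)}
  /\
  forall k : nat, (0 < k)%N -> (k < l)%N ->
  {ae mu, forall alpha : K, abs_ball abs 0 1 alpha ->
     frequency R (fun j => p%:R `^ (k%:R / e%:R) <= abs (c (a j) alpha)
                             < p%:R `^ (l%:R / e%:R)) @ \oo
       --> (1 / p%:R ^+ (f * (k - 1)) * (1 - 1 / p%:R ^+ (f * (l - k))) : R)}.
Proof.
case: a_good => a_gt0 a_incr _ /=.
have ultra := ext_ultra p_prime QpP absP abs_ext.
have b_gt1 := ext_b_gt1 p_prime absP eP abs_beta.
have abs_value := ext_abs_value p_prime QpP absP abs_ext eP abs_beta.
have res_le1 := residue_le1 p_prime QpP absP abs_ext gammaP.
have res_surj := residue_surj p_prime QpP absP abs_ext fP gammaP.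
have res_inj := residue_inj p_prime QpP absP abs_ext gammaP.
have flP := ext_floor_near p_prime QpP absP abs_ext eP fP gammaP abs_beta.
have fl_eq := ext_floor_eq p_prime QpP absP abs_ext eP fP gammaP abs_beta.
have powE (m : nat) : p%:R `^ (m%:R / e%:R) = abs beta ^+ m :> R.
  by rewrite abs_beta -powR_mulrn ?powR_ge0// -powRrM div1r mulrC.
have QE : #|{ffun 'I_f -> 'I_p}|%:R = p%:R ^+ f :> R.
  by rewrite card_ffun !card_ord natrX.
rewrite !exprM -QE; split=> [|k k_gt0 kl].
  have eq_l := frequency_floor_eq absP ultra b_gt1 abs_value res_le1 res_surj res_inj
    flP fl_eq muP mu_norm a_gt0 a_incr l_gt0.
  have ge_l := frequency_floor_ge absP ultra b_gt1 abs_value res_le1 res_surj res_inj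
    flP fl_eq muP mu_norm a_gt0 a_incr l_gt0.
  rewrite !powE; apply: filterS2 eq_l ge_l => x h1 h2 xB.
  by split; [exact: h1|exact: h2].
rewrite !exprM -QE !powE.
exact: (frequency_floor_ico absP ultra b_gt1 abs_value res_le1 res_surj res_inj
  flP fl_eq muP mu_norm a_gt0 a_incr k_gt0 kl).
Qed.
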